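(* Let $(G_\sigma)_{\sigma\ge1}$ and $X$ be as in the context, with $G_\sigma(\{1\})=0$ for all $\sigma>1$. Assume that $\beta=0$, so that $$\psi(\lambda)=\int_0^\infty\left(1-e^{-\lambda x}\right)\nu(dx).$$ Let $f$ be a $C^1$-function on $\mathbb{R}$ with the following property: there exist a function $N_f$ and a (signed) finite measure $M_f(s,x,z,d\lambda)$ such that, with $t=\sigma^2 s$, $$f\left(\sigma e^{-u/2}x+\sqrt t\sqrt{1-e^{-u}}\,z\right)=N_f(\sigma)\int_0^\infty e^{-\lambda u}M_f(s,x,z,d\lambda),\qquad u>0,$$ and $$\lim_{\sigma\downarrow1}N_f(\sigma)=1 .$$ Then, for any $s>0$, $$A_sf(x)=\frac{x}{2s}f'(x)+\frac{1}{2s}\int_{\mathbb{R}}\big[f(x+y)-f(x)\big]\int_0^{\infty}\phi\big((e^{-\omega/2}-1)x,\;s(1-e^{-\omega}),\;y\big)\,\nu(d\omega)\,dy .$$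
   Context: $\phi(\mu,v,\cdot)$ is the density of the Gaussian distribution with mean $\mu$ and variance $v$. A family $(G_\sigma)_{\sigma\ge1}$ of probability measures on $[0,1]$ is a log-convolution semi-group if, for all $\sigma,\tau\ge1$, the product of two independent random variables with distributions $G_\sigma$ and $G_\tau$ has distribution $G_{\sigma\tau}$. It has Laplace exponent $\psi(\lambda)=\beta\lambda+\int_0^\infty(1-e^{-\lambda x})\nu(dx)$ if, for $R_\sigma$ distributed as $G_\sigma$, $L_\sigma(\lambda):=\mathbb{E}[(R_\sigma)^\lambda]=\sigma^{-\psi(\lambda)}$ for all $\sigma\ge1$, $\lambda>0$, where $\beta\ge0$ and $\nu$ is a measure on $[0,\infty)$ with $\nu(\{0\})=0$ and $\int_0^\infty(1\wedge x)\nu(dx)<\infty$. Standing setting: $(G_\sigma)_{\sigma\ge1}$ is a log-convolution semi-group with Laplace exponent $\psi$ satisfying $\psi(1/2)=1$. $X$ is the Markov martingale with $X_0=0$ whose transition probabilities for $0<s<t$, with $\sigma=\sqrt{t/s}$, are (since $G_\sigma(\{1\})=0$) $$P_{s,t}(x,dy)=\left(\int_{[0,1)}\phi\big(\sigma\sqrt r\,x,\;t(1-r),\;y\big)\,G_\sigma(dr)\right)dy,$$ and $P_{0,t}(x,dy)=\phi(x,t,y)\,dy$. The infinitesimal generator is $A_sf(x)=\lim_{t\downarrow s}\frac{1}{t-s}\left(\int f(y)P_{s,t}(x,dy)-f(x)\right)$, $x\in\mathbb{R}$. In the property required of $f$, the identity is for all $s>0$, $x,z\in\mathbb{R}$, $\sigma>1$,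 $u>0$; the measure $M_f(s,x,z,\cdot)$ on $[0,\infty)$ does not depend on $\sigma$ or $u$, and $N_f$ depends only on $\sigma$.
   Formalization: The outer integral over y is read as the limit as e→0+ of the integrals over |y|>e, since it need not converge absolutely (e.g. f(y)=y, x=0, ν(dω)=cω^{-1-a}dω with 1/2≤a<1); it equals the Lebesgue integral whenever that exists. *)

(* Defs.v *)
From HB Require Import structures.
From mathcomp Require Import all_boot all_order all_algebra.
From mathcomp Require Import all_classical all_reals all_analysis.
From mathcomp Require Import measurable_realfun.

Set Implicit Arguments.
Unset Strict Implicit.
Unset Printing Implicit Defensive.

Import Order.TTheory GRing.Theory Num.Theory.
Import numFieldNormedType.Exports.

Local Open Scope classical_set_scope.
Local Open Scope ring_scope.

Section definitions.
Context {R : realType}.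
Local Notation mu := (@lebesgue_measure R).

(* The second argument is the variance, whereas that of [normal_pdf] is the
   standard deviation. *)
Definition gauss_density (m v y : R) : R := normal_pdf m (Num.sqrt v) y.

(* [\x] is the joint law of two independent variables.  Only the restriction of
   the family [G] to [1, +oo[ is meaningful. *)
Definition log_convolution_semigroup
    (G : R -> probability (measurableTypeR R) R) : Prop :=
  (forall sigma, 1 <= sigma -> G sigma `[0, 1]%classic = 1%E) /\
  (forall sigma tau, 1 <= sigma -> 1 <= tau ->
    forall A : set (measurableTypeR R), measurable A ->
      pushforward (G sigma \x G tau)%E (fun p => p.1 * p.2) A =
      G (sigma * tau) A).

Definition laplace_exponent (beta : R)
    (nu : {measure set (measurableTypeR R) -> \bar R}) (lambda : R) : R :=
  beta * lambda +
  \int[nu]_(w in `[0, +oo[) (1 - expR (- (lambda * w))).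

Definition has_laplace_exponent (G : R -> probability (measurableTypeR R) R)
    (beta : R) (nu : {measure set (measurableTypeR R) -> \bar R}) : Prop :=
  [/\ 0 <= beta,
      nu (~` `[0, +oo[%classic) = 0%E,
      nu [set 0] = 0%E,
      (\int[nu]_(w in `[0%R, +oo[) (Num.min 1 w)%:E < +oo)%E &
      forall sigma lambda, 1 <= sigma -> 0 < lambda ->
        (\int[G sigma]_(r in `[0%R, 1%R]) (r `^ lambda)%:E =
         (sigma `^ (- laplace_exponent beta nu lambda))%:E)%E].

(* Density of P_{s,t}(x, dy) for 0 <= s < t; it is extended-valued because the
   variance t (1 - r) vanishes as r tends to 1. *)
Definition transition_density (G : R -> probability (measurableTypeR R) R)
    (s t x y : R) : \bar R :=
  if s == 0 then (gauss_density x t y)%:E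
  else let sigma := Num.sqrt (t / s) in
    (\int[G sigma]_(r in `[0%R, 1%R[)
       (gauss_density (sigma * Num.sqrt r * x) (t * (1 - r)) y)%:E)%E.

Definition natural_filtration d (Omega : measurableType d) (X : R -> Omega -> R)
    (s : R) : set (set Omega) :=
  <<s \bigcup_(u in `[0, s]%classic) preimage_set_system setT (X u) measurable >>.

(* X is indexed by [0, +oo[; its values at negative times are irrelevant. *)
Definition markov_martingale (G : R -> probability (measurableTypeR R) R)
    d (Omega : measurableType d) (Pr : probability Omega R)
    (X : R -> {RV Pr >-> R}) : Prop :=
  [/\ {ae Pr, forall w, X 0 w = 0},
      forall s t, 0 <= s -> s < t ->
        forall (A : set Omega) (B : set (measurableTypeR R)),
          natural_filtration X s A -> measurable B ->
          Pr (A `&` X t @^-1` B) =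
          (\int[Pr]_(w in A)
             \int[mu]_(y in B) transition_density G s t (X s w) y)%E,
      forall t, 0 <= t -> Pr.-integrable setT (EFin \o X t) &
      forall s t, 0 <= s -> s <= t ->
        forall A : set Omega, natural_filtration X s A ->
          (\int[Pr]_(w in A) (X t w)%:E = \int[Pr]_(w in A) (X s w)%:E)%E].

(* A_s f(x) exists and equals l; the integrals of f against P_{s,t}(x, dy) have
   to converge for t close to s. *)
Definition is_generator (G : R -> probability (measurableTypeR R) R)
    (s : R) (f : R -> R) (x l : R) : Prop :=
  (\forall t \near s^'+, mu.-integrable setT
     (fun y => (f y)%:E * transition_density G s t x y)%E) /\
  ((fun t => (t - s)^-1 *
     (fine (\int[mu]_y ((f y)%:E * transition_density G s t x y)%E) - f x))
     @ s^'+ --> l).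

(* Integral of g over D against a signed finite measure, through its Jordan
   decomposition. *)
Definition charge_integral (M : {charge set (measurableTypeR R) -> \bar R})
    (D : set R) (g : R -> R) : R :=
  let hN := svalP (cid (Hahn_decomposition M)) in
  let hPN := svalP (cid hN) in
  \int[jordan_pos hPN]_(l in D) g l - \int[jordan_neg hPN]_(l in D) g l.

Definition C1 (f : R -> R) : Prop :=
  (forall x : R, derivable f x 1) /\ continuous f^`()%classic.

Definition laplace_scaling_property (f : R -> R) : Prop :=
  exists (Nf : R -> R)
    (Mf : R -> R -> R -> {charge set (measurableTypeR R) -> \bar R}),
    (forall s x z sigma u, 0 < s -> 1 < sigma -> 0 < u ->
       let t := sigma ^+ 2 * s in
       f (sigma * expR (- (u / 2)) * x +
          Num.sqrt t * Num.sqrt (1 - expR (- u)) * z) =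
       Nf sigma *
       charge_integral (Mf s x z) `[0, +oo[ (fun l => expR (- (l * u)))) /\
    (Nf @ 1^'+ --> (1 : R)).

(* Density, away from y = 0, of the measure of the jumps from x. *)
Definition jump_density (nu : {measure set (measurableTypeR R) -> \bar R})
    (s x y : R) : \bar R :=
  (\int[nu]_(w in `[0%R, +oo[)
     (gauss_density ((expR (- (w / 2)) - 1) * x) (s * (1 - expR (- w))) y)%:E)%E.

(* Integral over the real line of a function with a possibly non-integrable
   singularity at 0.  A jump density satisfies only
   \int (1 /\ y^2) jump_density dy < +oo, so that [f(x + y) - f(x)], of order y,
   need not be absolutely integrable against it; the integral then converges
   only as the limit of the integrals over |y| > e.  For an absolutely
   integrable function it is the Lebesgue integral: see
   [integrable_is_integral_off0]. *)
Definition is_integral_off0 (h : R -> \bar R) (I : R) : Prop :=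
  (forall e, 0 < e -> mu.-integrable [set y | e < `|y|] h) /\
  ((fun e => fine (\int[mu]_(y in [set y | (e < `|y|)%R]) h y)%E)
     @ 0^'+ --> I).

End definitions.

Lemma integrable_is_integral_off0 {R : realType} (h : R -> \bar R) :
  (@lebesgue_measure R).-integrable setT h ->
  is_integral_off0 h (fine (\int[@lebesgue_measure R]_y h y)%E).
Proof.
move=> ih.
have mA (e : R) : measurable ([set y | e < `|y|] : set (measurableTypeR R)).
  have -> : [set y : R | e < `|y|] = setT `&` (@Num.norm _ R @^-1` `]e, +oo[%classic).
    by rewrite setTI; apply/seteqP; split=> y /=; rewrite in_itv/= andbT.
  by apply: (@normr_measurable R setT) => //; exact: measurable_itv.
split=> [e _|].
  apply: (@integrableS _ _ R _ setT) => //; exact: mA.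
apply/cvg_at_rightP => u [u0 ucvg].
have [/integrableP[mh _] h0] := (ih, measurable_set1 (0 : R)).
pose A n := [set y : R | u n < `|y|].
have := @dominated_convergence _ _ R (@lebesgue_measure R) setT measurableT
  (fun n => h \_ (A n)) h (fun y => `|h y|)%E.
case=> [n|//||||_ _].
- apply: (iffLR (@measurable_restrictT _ _ _ _ (A n) h (mA _))).
  by apply: (measurable_funS measurableT) => //; exact: mh.
- exists [set 0]; split=> [||y /=]//; first exact: lebesgue_measure_set1.
  apply: contra_notP => y0 _; apply: cvg_near_cst => /=.
  have ay : 0 < `|y| by rewrite normr_gt0; apply/eqP.
  have [N _ hN] := cvgr0_norm_lt _ ucvg _ ay.
  exists N => // n /hN /= ltn; rewrite patchE mem_set// /A/=.
  by rewrite (le_lt_trans _ ltn)// ler_norm.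
- exact: integrable_abse.
- apply: aeW => y n _ /=; rewrite patchE; case: ifP => _ //.
  by rewrite abse0.
move=> H; apply: fine_cvg; rewrite fineK; last exact: integrable_fin_num.
by move: H; under eq_fun do rewrite -integral_mkcond.
Qed.

(* Main.v *)
Require Import Defs.
From HB Require Import structures.
From mathcomp Require Import all_boot all_order all_algebra.
From mathcomp Require Import all_classical all_reals all_analysis.
From mathcomp Require Import measurable_realfun.
From mathcomp Require Import ring lra.

Set Implicit Arguments.
Unset Strict Implicit.
Unset Printing Implicit Defensive.

Import Order.TTheory GRing.Theory Num.Theory.
Import numFieldNormedType.Exports.

Local Open Scope classical_set_scope.
Local Open Scope ring_scope.

(** The scaling property forces [f] to be a monomial.  Letting sigma tend to 1,
    it gives [f (sigma w) = N_f sigma * f w], and it makes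
    [u |-> f (e^{-u/2} - sqrt (1 - e^{-u}))] the Laplace transform of a finite
    signed measure.  Such a transform has Taylor expansions of all orders at
    [u = ln 2], where the argument of [f] vanishes with a nonzero derivative.
    If [f] is not zero, homogeneity excludes that all the coefficients vanish,
    so [f v / v ^ n] has a nonzero limit at 0 for some [n], and homogeneity
    again yields [f w = c w ^ n].

    The [n]-th moment of a Gaussian of mean [x tau] and variance
    [s (1 - tau^2)] is a polynomial [Q] in [tau] with [Q 1 = x ^ n].  Hence
    [int f dP_{s,t} = c sigma^n E (Q (sqrt R_sigma))] is a linear combination
    of powers [sigma ^ (n - psi (j / 2))], to be differentiated at [t = s]; and
    the integral of [f (x + y) - f x] against the jumps is
    [c int (Q (e^{-w/2}) - Q 1) nu(dw)].  The latter exchange of integrals is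
    made on [|y| > e] and the limit is taken by dominated convergence: the part
    of [f (x + y) - f x] linear in [y] contributes at most
    [O (1 /\ w)], since the integral of [y] against a Gaussian of mean [m] over
    a set symmetric about 0 is at most [|m|] in absolute value. *)

Local Notation mu := lebesgue_measure.

(** * Homogeneous functions with the scaling property *)

Lemma expR_taylor_le (R : realType) (k : nat) (x : R) :
  `|expR x - \sum_(j < k) x ^+ j / j`!%:R| <= `|x| ^+ k * expR `|x|.
Proof.
have leE n (y : R) : 0 <= y -> \sum_(j < n) y ^+ j / j`!%:R <= expR y.
  move=> y0; rewrite /expR.
  have -> : \sum_(j < n) y ^+ j / j`!%:R = series (exp_coeff y) n.
    by rewrite /series/= big_mkord.
  apply: nondecreasing_cvgn_le; last exact: is_cvg_series_exp_coeff.
  by apply: nondecreasing_series => i _ _; rewrite /exp_coeff divr_ge0// exprn_ge0.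
have cx : series (exp_coeff x) n @[n --> \oo] --> expR x.
  exact: is_cvg_series_exp_coeff.
have cn : `|series (exp_coeff x) n - \sum_(j < k) x ^+ j / j`!%:R| @[n --> \oo]
    --> `|expR x - \sum_(j < k) x ^+ j / j`!%:R|.
  by apply: cvg_norm; apply: cvgB => //; exact: cvg_cst.
rewrite -(cvg_lim _ cn)//; apply: limr_le; first by apply/cvg_ex; eexists; exact: cn.
near=> n; rewrite /series/=.
have kn : (k <= n)%N by near: n; exact: nbhs_infty_ge.
rewrite (@big_cat_nat _ _ _ k)//= big_mkord /exp_coeff/=.
rewrite addrAC subrr add0r.
apply: (le_trans (ler_norm_sum _ _ _)).
rewrite -{1}(add0n k) big_addn big_mkord.
apply: (@le_trans _ _ (\sum_(i < n - k) `|x| ^+ k * (`|x| ^+ i / i`!%:R))).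
  apply: ler_sum => i _; rewrite /exp_coeff normrM normrX exprD normfV normr_nat.
  rewrite (mulrC (`|x| ^+ i)) -mulrA ler_wpM2l// ?exprn_ge0//.
  rewrite ler_wpM2l// ?exprn_ge0// lef_pV2 ?posrE ?ltr0n ?fact_gt0//.
  by rewrite ler_nat leq_fact// leq_addr.
by rewrite -mulr_sumr ler_wpM2l ?exprn_ge0// leE.
Unshelve. all: by end_near. Qed.

Lemma exprn_le_expR (R : realType) (k : nat) (x : R) :
  0 <= x -> x ^+ k <= k`!%:R * expR x.
Proof.
move=> x0; case: k => [|k]; first by rewrite expr0 fact0 mul1r -[leLHS]expR0 ler_expR.
have := expR_ge1Dxn k x0; rewrite -ler_pdivrMl ?ltr0n ?fact_gt0// mulrC.
by apply: le_trans; rewrite lerDr.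
Qed.

Lemma laplace_peano (R : realType)
    (m : {finite_measure set (measurableTypeR R) -> \bar R}) (u : R) (k : nat) :
  0 < u -> exists (a : nat -> R) (C : R), forall h, `|h| <= u / 2 ->
    `|\int[m]_(l in `[0%R, +oo[) expR (- (l * (u + h))) -
      \sum_(j < k) a j * h ^+ j| <= C * `|h| ^+ k.
Proof.
move=> u0; set D := `[0, +oo[%classic.
have mD : measurable (D : set (measurableTypeR R)) by exact: measurable_itv.
pose mon j (l : R) := l ^+ j * expR (- (l * (u / 2))).
have mmon j : measurable_fun D (mon j).
  apply: measurable_funTS; apply: measurable_funM.
    exact: measurable_funX.
  apply: measurableT_comp => //; apply: measurableT_comp => //.
  exact: measurable_funM.
have imon j : m.-integrable D (EFin \o mon j).
  apply: measurable_bounded_integrable => //; first by rewrite ltey_eq fin_num_measure.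
    exact: mmon.
  exists (j`!%:R * (2 / u) ^+ j); split; first exact: num_real.
  move=> M hM l; rewrite /D/= in_itv/= andbT => l0.
  apply: le_trans (ltW hM); rewrite ger0_norm ?mulr_ge0 ?exprn_ge0 ?expR_ge0//.
  rewrite /mon expRN ler_pdivrMr ?expR_gt0//.
  have l2 : 0 <= l * (u / 2) by rewrite mulr_ge0// divr_ge0// ltW.
  have := exprn_le_expR j l2.
  rewrite exprMn -ler_pdivlMr ?exprn_gt0 ?divr_gt0// => /le_trans; apply.
  by rewrite -exprVn invf_div mulrAC.
have iexp h : `|h| <= u / 2 -> m.-integrable D (EFin \o (fun l => expR (- (l * (u + h))))).
  move=> hu; apply: (le_integrable mD _ _ (imon 0)).
    apply/measurable_EFinP/measurable_funTS; apply: measurableT_comp => //.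
    apply: measurableT_comp => //; exact: measurable_funM.
  move=> l; rewrite /D/= in_itv/= andbT => l0; rewrite lee_fin.
  rewrite /mon expr0 mul1r !ger0_norm ?expR_ge0// ler_expR lerN2.
  by rewrite ler_wpM2l//; move: hu; rewrite ler_norml => /andP[]; lra.
pose A j (l : R) := (- l) ^+ j / j`!%:R * expR (- (l * u)).
have iA j : m.-integrable D (EFin \o A j).
  apply: (le_integrable mD _ _ (imon j)).
    apply/measurable_EFinP/measurable_funTS; apply: measurable_funM.
      apply: measurable_funM => //; apply: measurable_funX.
      exact: oppr_measurable.
    apply: measurableT_comp => //; apply: measurableT_comp => //.
    exact: measurable_funM.
  move=> l; rewrite /D/= in_itv/= andbT => l0; rewrite lee_fin.
  rewrite /A /mon !normrM !normrX normrN.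
  rewrite (ger0_norm (expR_ge0 _)) (ger0_norm (expR_ge0 _)).
  apply: ler_pM; rewrite ?mulr_ge0 ?exprn_ge0 ?expR_ge0//.
    rewrite ler_piMr ?exprn_ge0// normfV normr_nat invf_le1 ?ltr0n ?fact_gt0//.
    by rewrite ler1n fact_gt0.
  by rewrite ler_expR lerN2 ler_wpM2l//; lra.
have iAh h j : m.-integrable D (fun l => (A j l * h ^+ j)%:E).
  apply: eq_integrable (integrableZl mD (h ^+ j) (iA j)) => // l _ /=.
  by rewrite -EFinM mulrC.
exists (fun j => \int[m]_(l in D) A j l), (\int[m]_(l in D) mon k l) => h hu.
have -> : \sum_(j < k) \int[m]_(l in D) A j l * h ^+ j =
    \int[m]_(l in D) (\sum_(j < k) A j l * h ^+ j).
  rewrite /Rintegral; under [in RHS]eq_integral do rewrite -sumEFin.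
  rewrite integral_sum//.
  rewrite -sum_fine//; last first.
    by move=> j _; apply: integrable_fin_num => //; exact: iAh.
  by apply: eq_bigr => j _; rewrite -RintegralZr//; exact: iA.
have iS : m.-integrable D (EFin \o (fun l => \sum_(j < k) A j l * h ^+ j)).
  rewrite (_ : _ \o _ = (fun l => \sum_(j < k) (A j l * h ^+ j)%:E)%E); last first.
    by apply/funext => l /=; rewrite sumEFin.
  apply: integrable_sum => // j _; exact: iAh.
rewrite -RintegralB//; last exact: iexp.
have iB := integrableB mD (iexp h hu) iS.
apply: (le_trans (le_normr_Rintegral mD iB)).
rewrite -RintegralZr//.
apply: le_Rintegral => //.
- exact: integrable_abse iB.
- apply: eq_integrable (integrableZl mD (`|h| ^+ k) (imon k)) => // l _ /=.
  by rewrite -EFinM mulrC.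
move=> l; rewrite /D/= in_itv/= andbT => l0.
have -> : expR (- (l * (u + h))) - \sum_(j < k) A j l * h ^+ j =
   expR (- (l * u)) * (expR (- (l * h)) - \sum_(j < k) (- (l * h)) ^+ j / j`!%:R).
  rewrite mulrBr -expRD; congr (expR _ - _); first by ring.
  rewrite mulr_sumr; apply: eq_bigr => j _; rewrite /A -(mulNr l h) exprMn; ring.
rewrite normrM ger0_norm ?expR_ge0//.
apply: (le_trans (ler_wpM2l (expR_ge0 _) (expR_taylor_le k _))).
rewrite normrN normrM (ger0_norm l0) exprMn.
rewrite mulrCA -expRD [leRHS]mulrAC ler_wpM2l ?mulr_ge0 ?exprn_ge0//.
rewrite ler_expR.
have := ler_wpM2l l0 hu; lra.
Qed.

Lemma charge_laplace_peano (R : realType)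
    (M : {charge set (measurableTypeR R) -> \bar R}) (u : R) (k : nat) :
  0 < u -> exists (a : nat -> R) (C : R), forall h, `|h| <= u / 2 ->
    `|charge_integral M `[0, +oo[ (fun l => expR (- (l * (u + h)))) -
      \sum_(j < k) a j * h ^+ j| <= C * `|h| ^+ k.
Proof.
move=> u0; rewrite /charge_integral.
set P := jordan_pos _; set Q := jordan_neg _.
have [a [A hA]] := laplace_peano P k u0.
have [b [B hB]] := laplace_peano Q k u0.
exists (fun j => a j - b j), (A + B) => h hu.
under eq_bigr do rewrite mulrBl.
rewrite sumrB mulrDl; apply: le_trans (lerD (hA _ hu) (hB _ hu)).
apply: le_trans (ler_normB _ _); rewrite le_eqVlt; apply/orP; left; apply/eqP.
congr Num.norm; ring.
Qed.

Lemma cvg_exprn (R : realType) (T : Type) (F : set_system T) {FF : Filter F}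
    (u : T -> R) (l : R) (n : nat) :
  u x @[x --> F] --> l -> u x ^+ n @[x --> F] --> l ^+ n.
Proof. by move=> ul; apply: (cvg_comp u (fun x => x ^+ n)) ul _; exact: exprn_continuous. Qed.

Lemma leading_term (R : realType) (F h : R -> R) (b C : R) (a : nat -> R)
    (k : nat) :
  b != 0 -> h v / v @[v --> 0^'] --> b ->
  (\forall v \near 0^', `|F v - \sum_(j < k) a j * h v ^+ j| <= C * `|h v| ^+ k) ->
  (exists D : R, \forall v \near 0^', `|F v| <= D * `|v| ^+ k) \/
  (exists (j : nat) (l : R), l != 0 /\ F v / v ^+ j @[v --> 0^'] --> l).
Proof.
move=> b0 hb hF.
have v_neq0 : \forall v \near (0 : R)^', v != 0 by exact: nbhs_dnbhs_neq.
have h0 : h v @[v --> 0^'] --> 0.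
  have : h v / v * v @[v --> 0^'] --> b * 0.
    by apply: cvgM => //; apply: cvg_within_filter; exact: cvg_id.
  rewrite mulr0; apply: cvg_trans; apply: near_eq_cvg.
  by near=> v; rewrite divfK//; near: v.
have hn0 : \forall v \near 0^', h v != 0.
  have : \forall v \near 0^', h v / v != 0.
    by apply: (cvgr_neq0 b).
  by apply: filterS => v; apply: contraNneq => ->; rewrite mul0r.
have [/existsP[i ai]|] := boolP [exists j : 'I_k, a j != 0]; last first.
  rewrite negb_exists => /forallP ak; left.
  exists (`|C| * (`|b| + 1) ^+ k).
  have hbd : \forall v \near 0^', `|h v / v| <= `|b| + 1.
    have := cvgr_norm_le _ hb; apply; by rewrite ltrDl.
  near=> v.
  have -> : F v = F v - \sum_(j < k) a j * h v ^+ j.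
    rewrite big1 ?subr0// => j _.
    by have := ak j; rewrite negbK => /eqP ->; rewrite mul0r.
  apply: (@le_trans _ _ (`|C| * `|h v| ^+ k)).
    apply: (@le_trans _ _ (C * `|h v| ^+ k)); first by near: v.
    by rewrite ler_wpM2r ?exprn_ge0// ler_norm.
  rewrite -mulrA ler_wpM2l// -exprMn lerXn2r ?nnegrE ?mulr_ge0 ?addr_ge0//.
  have vn : v != 0 by near: v.
  rewrite -[h v](divfK vn) normrM ler_wpM2r//.
  by near: v.
have {i ai}ex : exists j, (j < k)%N && (a j != 0).
  by exists i; rewrite ltn_ord.
case: (ex_minnP ex) => j /andP[jk aj] jmin; right.
exists j, (a j * b ^+ j); split; first by rewrite mulf_neq0// expf_neq0.
pose p := \poly_(i < k - j) a (j + i)%N.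
have sumE x : \sum_(i < k) a i * x ^+ i = x ^+ j * p.[x].
  rewrite -(big_mkord xpredT (fun i => a i * x ^+ i)).
  rewrite (@big_cat_nat _ _ _ j)/= ?(ltnW jk)// big_mkord.
  rewrite big1 ?add0r => [|i _].
    rewrite -{1}(add0n j) big_addn big_mkord horner_poly mulr_sumr.
    by apply: eq_bigr => i _; rewrite addnC exprD mulrCA.
  have [->|ai] := eqVneq (a i) 0; first by rewrite mul0r.
  have := jmin i; rewrite ai (ltn_trans (ltn_ord i) jk) => /(_ isT).
  by rewrite leqNgt ltn_ord.
have ph : p.[h v] @[v --> 0^'] --> a j.
  have -> : a j = p.[0].
    by rewrite horner_coef0 coef_poly subn_gt0 jk addn0.
  by apply: (cvg_comp h (horner p)) h0 _; exact: continuous_horner.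
have hk : `|C| * `|h v| ^+ (k - j) @[v --> 0^'] --> 0.
  rewrite [X in _ --> X](_ : _ = `|C| * `|0 : R| ^+ (k - j)); last first.
    by rewrite normr0 expr0n subn_eq0 leqNgt jk mulr0.
  by apply: cvgMr; apply: cvg_exprn; exact: cvg_norm.
have Gp : F v / h v ^+ j - p.[h v] @[v --> 0^'] --> 0.
  apply/norm_cvg0P; apply: squeeze_cvgr (cvg_cst 0) hk.
  near=> v; rewrite normr_ge0/=.
  have hv : h v != 0 by near: v.
  have hj : h v ^+ j != 0 by rewrite expf_neq0.
  have -> : F v / h v ^+ j - p.[h v] = (F v - \sum_(i < k) a i * h v ^+ i) / h v ^+ j.
    by rewrite sumE mulrBl [X in _ = _ - X]mulrAC divff// mul1r.
  rewrite normrM normfV normrX ler_pdivrMr ?exprn_gt0 ?normr_gt0//.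
  rewrite -mulrA -exprD subnK ?(ltnW jk)//.
  apply: (@le_trans _ _ (C * `|h v| ^+ k)); first by near: v.
  by rewrite ler_wpM2r ?exprn_ge0// ler_norm.
have : (F v / h v ^+ j - p.[h v] + p.[h v]) * (h v / v) ^+ j @[v --> 0^'] -->
    (0 + a j) * b ^+ j.
  by apply: cvgM; [exact: cvgD|exact: cvg_exprn].
rewrite add0r; apply: cvg_trans; apply: near_eq_cvg; near=> v.
have hv : h v != 0 by near: v.
have hj : h v ^+ j != 0 by rewrite expf_neq0.
by rewrite subrK exprMn exprVn mulrA divfK.
Unshelve. all: by end_near. Qed.

Lemma homogeneous_monomial (R : realType) (f N : R -> R) :
  continuous f ->
  (forall sigma w : R, 1 < sigma -> f (sigma * w) = N sigma * f w) ->
  (forall k, (exists D : R, \forall v \near 0^', `|f v| <= D * `|v| ^+ k) \/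
     (exists (j : nat) (l : R), l != 0 /\ f v / v ^+ j @[v --> 0^'] --> l)) ->
  exists (c : R) (n : nat), forall w : R, f w = c * w ^+ n.
Proof.
move=> cf hN hk.
have [f0|] := pselect (forall w : R, w != 0 -> f w = 0).
  exists 0, 0%N => w; rewrite mul0r; have [->|/f0//] := eqVneq w 0.
  have fc : f v @[v --> 0^'] --> f 0 by apply: cvg_within_filter; exact: cf.
  have f00 : f v @[v --> 0^'] --> 0.
    apply: cvg_near_cst; near=> v; apply: f0; near: v.
    exact: nbhs_dnbhs_neq.
  exact: (cvg_unique _ fc f00).
move=> /existsNP[w0 /not_implyP[w0n /eqP fw0]].
have hNX m w : f w = N 2 ^+ m * f (w / 2 ^+ m).
  elim: m => [|m IH]; first by rewrite !expr0 invr1 mulr1 mul1r.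
  rewrite IH exprSr -mulrA -hN ?ltr1n//; congr (_ * f _).
  by rewrite exprS invfM mulrCA (mulrA 2) divff// mul1r.
have N2 : N 2 != 0.
  by apply: contraNneq fw0 => N20; rewrite (hNX 1%N) expr1 N20 mul0r.
have to0 (w : R) : w != 0 -> w / 2 ^+ m @[m --> \oo] --> (0 : R)^'.
  move=> wn.
  have w2 : w / 2 ^+ m @[m --> \oo] --> (0 : R).
    rewrite -(mulr0 w); apply: cvgMr.
    under eq_fun do rewrite -exprVn.
    by apply: cvg_expr; rewrite ger0_norm// invf_lt1// ltr1n.
  move=> P hP.
  have h : \forall m \near \oo, w / 2 ^+ m != 0 -> P (w / 2 ^+ m) := w2 _ hP.
  change (\forall m \near \oo, P (w / 2 ^+ m)).
  by apply: filterS h => m; apply; rewrite mulf_neq0// invr_neq0// expf_neq0.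
have [j [l [l0 fl]]] : exists (j : nat) (l : R), l != 0 /\ f v / v ^+ j @[v --> 0^'] --> l.
  pose k := Num.bound `|N 2|.
  have Nk : `|N 2| < 2 ^+ k.
    apply: (@lt_le_trans _ _ k%:R); first by rewrite archi_boundP.
    by rewrite -natrX ler_nat ltnW// ltn_expl.
  have [[D hD]|//] := hk k.
  suff: f w0 = 0 by move/eqP; rewrite (negbTE fw0).
  have q0 : `|D| * `|w0| ^+ k * (`|N 2| / 2 ^+ k) ^+ m @[m --> \oo] --> 0.
    rewrite -[X in _ --> X](mulr0 (`|D| * `|w0| ^+ k)); apply: cvgMr.
    apply: cvg_expr; rewrite ger0_norm ?divr_ge0 ?exprn_ge0//.
    by rewrite ltr_pdivrMr ?exprn_gt0// mul1r.
  have fw00 : f w0 @[m --> \oo] --> 0.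
    apply/norm_cvg0P; apply: squeeze_cvgr (cvg_cst 0) q0.
    have hm : \forall m \near \oo, `|f (w0 / 2 ^+ m)| <= D * `|w0 / 2 ^+ m| ^+ k.
      exact: to0 _ w0n _ hD.
    near=> m; rewrite normr_ge0/=.
    rewrite (hNX m) normrM normrX exprMn mulrCA ler_wpM2l ?exprn_ge0//.
    apply: (@le_trans _ _ (D * `|w0 / 2 ^+ m| ^+ k)); first by near: m.
    rewrite normrM normfV normrX (ger0_norm (ler0n _ 2)).
    rewrite exprMn !exprVn -exprM mulnC exprM mulrA.
    by rewrite ler_wpM2r ?invr_ge0 ?exprn_ge0// ler_wpM2r ?exprn_ge0// ler_norm.
  exact: (cvg_unique _ (cvg_cst _) fw00).
have Nj sigma : 1 < sigma -> N sigma = sigma ^+ j.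
  move=> s1; have s0 : sigma != 0 by rewrite gt_eqF// (lt_trans _ s1).
  have h1 := cvg_comp _ _ (to0 _ w0n) fl.
  have h2 := cvg_comp _ _ (to0 _ (mulf_neq0 s0 w0n)) fl.
  have h3 : N sigma / sigma ^+ j * (f (w0 / 2 ^+ m) / (w0 / 2 ^+ m) ^+ j)
      @[m --> \oo] --> N sigma / sigma ^+ j * l by apply: cvgMr.
  have e : N sigma / sigma ^+ j * l = l.
    suff h4 : N sigma / sigma ^+ j * (f (w0 / 2 ^+ m) / (w0 / 2 ^+ m) ^+ j)
      @[m --> \oo] --> l by exact: (cvg_unique _ h3 h4).
    apply: cvg_trans h2; apply: near_eq_cvg; apply: nearW => m /=.
    have -> : sigma * w0 / 2 ^+ m = sigma * (w0 / 2 ^+ m) by rewrite mulrA.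
    by set w := w0 / _; rewrite hN// exprMn invfM mulrACA.
  have sj : sigma ^+ j != 0 by rewrite expf_neq0.
  rewrite -[LHS](divfK sj) -[RHS]mul1r; congr (_ * _).
  by apply: (mulIf l0); rewrite mul1r.
exists l, j.
have fw w : w != 0 -> f w = l * w ^+ j.
  move=> wn; have wj : w ^+ j != 0 by rewrite expf_neq0.
  apply: (canRL (divfK wj)).
  have h1 := cvg_comp _ _ (to0 _ wn) fl.
  suff h2 : f w / w ^+ j @[m --> \oo] --> l.
    exact: (cvg_unique _ (cvg_cst _) h2).
  apply: cvg_trans h1; apply: near_eq_cvg.
  apply: nearW => m /=.
  rewrite (hNX m w) Nj ?ltr1n// exprMn invfM exprVn invrK -!exprM (mulnC j).
  ring.
move=> w; have [->|/fw//] := eqVneq w 0.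
have fc : f v @[v --> 0^'] --> f 0 by apply: cvg_within_filter; exact: cf.
suff f0 : f v @[v --> 0^'] --> l * 0 ^+ j by exact: (cvg_unique _ fc f0).
have : l * v ^+ j @[v --> 0^'] --> l * 0 ^+ j.
  apply: cvgMr; apply: cvg_exprn; apply: cvg_within_filter; exact: cvg_id.
apply: cvg_trans; apply: near_eq_cvg; near=> v; apply/esym/fw; near: v.
exact: nbhs_dnbhs_neq.
Unshelve. all: by end_near. Qed.

Lemma is_derive_quotient (R : realType) (f : R -> R) (a df : R) :
  is_derive a 1 f df -> (f (h + a) - f a) / h @[h --> 0^'] --> df.
Proof.
move=> [dv <-]; have := dv; apply: cvg_trans; apply: near_eq_cvg.
by apply: nearW => h /=; rewrite mulrC [h *: _]mulr1.
Qed.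

(* The substitution [u = - ln ((1 + v sqrt (2 - v^2)) / 2)] inverts
   [v = e^{-u/2} - sqrt (1 - e^{-u})] near its zero [u = ln 2]. *)
Lemma laplace_scaling_monomial (R : realType) (f : R -> R) :
  continuous f -> laplace_scaling_property f ->
  exists (c : R) (n : nat), forall w : R, f w = c * w ^+ n.
Proof.
move=> cf [N [M [hfM N1]]].
have fM (x z u : R) : 0 < u ->
    f (expR (- (u / 2)) * x + Num.sqrt (1 - expR (- u)) * z) =
    charge_integral (M 1 x z) `[0, +oo[ (fun l => expR (- (l * u))).
  move=> u0; set K := charge_integral _ _ _.
  pose g (sigma : R) := sigma * expR (- (u / 2)) * x +
    sigma * Num.sqrt (1 - expR (- u)) * z.
  have gN : \forall sigma \near 1^'+, f (g sigma) = N sigma * K.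
    near=> sigma; have s1 : 1 < sigma by near: sigma; exact: nbhs_right_gt.
    have s0 : 0 <= sigma by rewrite ltW// (lt_trans _ s1).
    rewrite /K -hfM// mulr1 sqrtr_sqr ger0_norm//.
  have h1 : N sigma * K @[sigma --> 1^'+] --> 1 * K by apply: cvgMl.
  have g1 : g sigma @[sigma --> 1^'+] --> g 1.
    apply: cvg_within_filter; rewrite /g.
    apply: (@cvgD _ R^o); (apply: cvgMl; apply: cvgMl; exact: cvg_id).
  have h2 : f (g sigma) @[sigma --> 1^'+] --> f (g 1).
    by apply: (cvg_comp g f) g1 _; exact: cf.
  suff h3 : f (g sigma) @[sigma --> 1^'+] --> 1 * K.
    have e : f (g 1) = 1 * K by exact: (cvg_unique _ h2 h3).
    by move: e; rewrite /g !mul1r.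
  by apply: cvg_trans h1; apply: near_eq_cvg; apply: filterS gN.
have fN (sigma w : R) : 1 < sigma -> f (sigma * w) = N sigma * f w.
  move=> s1; pose u : R := - ln (3 / 4).
  have eu : expR (- u) = 3 / 4 by rewrite opprK lnK// posrE.
  have u0 : 0 < u by rewrite oppr_gt0 ln_lt0// ltr_pdivlMr// ltr_pdivrMr//; lra.
  have s14 : Num.sqrt (1 - expR (- u)) = 1 / 2.
    have -> : 1 - expR (- u) = (1 / 2) ^+ 2 by rewrite eu; field.
    by rewrite sqrtr_sqr ger0_norm.
  have := fM 0 (2 * w) u u0; rewrite mulr0 add0r s14.
  have -> : 1 / 2 * (2 * w) = w by field.
  have s0 : 0 <= sigma by rewrite ltW// (lt_trans _ s1).
  move=> ->; rewrite -hfM// mulr0 add0r s14 mulr1 sqrtr_sqr.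
  by rewrite ger0_norm//; congr f; field.
apply: homogeneous_monomial fN _ => // k.
pose g (v : R) : R := 1 + v * Num.sqrt (2 - v ^+ 2).
have u0 : 0 < ln 2 :> R by rewrite ln_gt0// ltr1n.
have [a [C haC]] := charge_laplace_peano (M 1 1 (-1)) k u0.
pose h v := - ln (g v).
have g0 : g 0 = 1 by rewrite /g mul0r addr0.
have dsq : is_derive (0 : R) 1 (fun v : R => 2 - v ^+ 2) 0.
  by apply: is_derive_eq; rewrite !scale0r addr0 oppr0 mulr0.
have dS : is_derive (0 : R) 1 (fun v : R => Num.sqrt (2 - v ^+ 2)) 0.
  have d2 : is_derive ((fun v : R => 2 - v ^+ 2) 0) 1 Num.sqrt
      (2 * Num.sqrt ((fun v : R => 2 - v ^+ 2) 0))^-1.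
    by apply: is_derive1_sqrt; rewrite expr0n subr0.
  by have := @is_derive1_comp _ Num.sqrt _ 0 _ _ d2 dsq; rewrite mulr0.
have dg : is_derive (0 : R) 1 g (Num.sqrt 2).
  apply: is_derive_eq; rewrite !expr0n /= subr0 scale0r !add0r.
  by rewrite mul1r [LHS]mulr1.
have dh : is_derive (0 : R) 1 h (- Num.sqrt 2).
  have dl : is_derive (g 0) 1 (@ln R) (g 0)^-1 by apply: is_derive1_ln; rewrite g0.
  have := @is_derive1_comp _ (@ln R) g 0 _ _ dl dg; rewrite g0 invr1 mul1r => dlg.
  exact: is_deriveN.
have h0 : h 0 = 0 by rewrite /h g0 ln1 oppr0.
have hv : h v / v @[v --> 0^'] --> - Num.sqrt 2.
  have := is_derive_quotient dh; apply: cvg_trans; apply: near_eq_cvg.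
  by apply: nearW => v /=; rewrite addr0 h0 subr0.
apply: (leading_term (a := a) (C := C) _ hv).
  by rewrite oppr_eq0 gt_eqF// sqrtr_gt0.
have ch : h v @[v --> 0^'] --> 0.
  rewrite -[X in _ --> X]h0; apply: cvg_within_filter.
  by apply: differentiable_continuous; apply/derivable1_diffP; case: dh.
have hsmall : \forall v \near 0^', `|h v| <= ln 2 / 2.
  have := cvgr_norm_le _ ch; apply; rewrite normr0 divr_gt0//.
near=> v.
have v1 : `|v| < 1.
  near: v; apply: dnbhs0_lt; exact: ltr01.
have -> : f v = charge_integral (M 1 1 (-1)) `[0, +oo[ (fun l => expR (- (l * (ln 2 + h v)))).
  set S := Num.sqrt (2 - v ^+ 2).
  have v21 : v ^+ 2 < 1 by rewrite -real_normK ?num_real// expr_lt1.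
  have S2 : S ^+ 2 = 2 - v ^+ 2 by rewrite sqr_sqrtr//; lra.
  have S0 : 0 < S by rewrite sqrtr_gt0; lra.
  have y2 : (v * S) ^+ 2 = 1 - (1 - v ^+ 2) ^+ 2 by rewrite exprMn S2; ring.
  have y21 : (v * S) ^+ 2 < 1.
    by rewrite y2 ltrBlDr ltrDl exprn_gt0// subr_gt0.
  have [y1 y1'] : -1 < v * S /\ v * S < 1.
    by apply/andP; rewrite -ltr_norml -(@expr_lt1 _ 2)// real_normK ?num_real.
  have gE : g v = 1 + v * S by [].
  have gv0 : 0 < g v by rewrite gE; lra.
  have uE : ln 2 + h v = - ln (g v / 2).
    by rewrite lnM ?posrE// lnV ?posrE// opprD opprK addrC.
  have eu : expR (- (ln 2 + h v)) = g v / 2.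
    by rewrite uE opprK lnK// posrE divr_gt0.
  rewrite -fM; last first.
    by rewrite uE oppr_gt0 ln_lt0// divr_gt0//= gE ltr_pdivrMr//; lra.
  rewrite eu; set A := expR _; set B := Num.sqrt _.
  have A0 : 0 < A by exact: expR_gt0.
  have A2 : A ^+ 2 = g v / 2.
    by rewrite -eu expr2 -expRD; congr expR; field.
  have B0 : 0 <= B by exact: sqrtr_ge0.
  have B2 : B ^+ 2 = 1 - g v / 2 by rewrite sqr_sqrtr// gE; lra.
  have AB : 2 * (A * B) = 1 - v ^+ 2.
    have AB0 : 0 <= 2 * (A * B) by rewrite !mulr_ge0// ltW.
    have v0 : 0 <= 1 - v ^+ 2 by rewrite subr_ge0 ltW.
    apply/eqP; rewrite -(@eqrXn2 _ 2)//.
    by apply/eqP; rewrite !exprMn A2 B2 gE; move: y2; rewrite exprMn; lra.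
  have ABS : A + B = S.
    apply/eqP; rewrite -(@eqrXn2 _ 2)// ?addr_ge0// ?(ltW A0)// ?(ltW S0)//.
    by apply/eqP; rewrite sqrrD A2 B2 S2 -(mulr_natl (A * B)) AB; ring.
  congr f; apply: (mulIf (lt0r_neq0 S0)).
  rewrite -{2}ABS mulr1 mulrN1 -subr_sqr A2 B2 gE; lra.
apply: haC; near: v; exact: hsmall.
Unshelve. all: by end_near. Qed.

(** * Gaussian moments and mixtures *)

Section gauss_density_theory.
Context (R : realType).
Implicit Types (m v y : R) (p : {poly R}).

Lemma gauss_densityE m v y : 0 < v ->
  gauss_density m v y =
  (Num.sqrt (v * pi *+ 2))^-1 * expR (- (y - m) ^+ 2 / (v *+ 2)).
Proof.
move=> v0; rewrite /gauss_density normal_pdfE ?gt_eqF ?sqrtr_gt0//.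
by rewrite /normal_peak /normal_fun sqr_sqrtr ?ltW.
Qed.

Lemma gauss_density_ge0 m v y : 0 <= gauss_density m v y.
Proof. exact: normal_pdf_ge0. Qed.

Lemma measurable_gauss_density m v : measurable_fun setT (gauss_density m v).
Proof. exact: measurable_normal_pdf. Qed.

Lemma integrable_gauss_density m v :
  mu.-integrable setT (EFin \o gauss_density m v).
Proof. exact: integrable_normal_pdf. Qed.

Lemma integral_gauss_density m v : \int[mu]_y gauss_density m v y = 1.
Proof. by rewrite /Rintegral /gauss_density integral_normal_pdf. Qed.

Lemma exprn_gauss_density_le m v (k : nat) : 0 < v ->
  exists2 C, 0 <= C &
    forall y, `|y| ^+ k * gauss_density m v y <= C * gauss_density m (v *+ 2) y.
Proof.
move=> v0; have v2 : 0 < v *+ 2 by rewrite mulrn_wgt0.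
pose P w : R := (Num.sqrt (w * pi *+ 2))^-1.
have P0 w : 0 < w -> 0 < P w.
  by move=> w0; rewrite invr_gt0 sqrtr_gt0 mulrn_wgt0// mulr_gt0// pi_gt0.
exists (k`!%:R * expR (`|m| + v) * (P v / P (v *+ 2))).
  by rewrite !mulr_ge0 ?expR_ge0 ?invr_ge0 ?(ltW (P0 _ _)).
move=> y; rewrite !gauss_densityE// -/(P v) -/(P (v *+ 2)).
set A := expR (- _ / _); set B := expR (- _ / _).
have -> : k`!%:R * expR (`|m| + v) * (P v / P (v *+ 2)) * (P (v *+ 2) * B) =
    P v * (k`!%:R * expR (`|m| + v) * B).
  by rewrite [RHS]mulrCA -mulrA; congr (_ * _); field; rewrite gt_eqF// P0.
rewrite mulrCA ler_wpM2l ?(ltW (P0 _ v0))//.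
have AB : A = B * B by rewrite /A /B -expRD; congr expR; field; rewrite gt_eqF.
rewrite AB mulrA ler_wpM2r ?expR_ge0//.
apply: (le_trans (ler_wpM2r (expR_ge0 _) (exprn_le_expR k (normr_ge0 y)))).
rewrite -mulrA ler_wpM2l// -expRD ler_expR.
have ym : `|y| <= `|m| + `|y - m| by rewrite -{1}(subrK m y) addrC ler_normD.
have vne : v != 0 by rewrite gt_eqF.
have : 0 <= (`|y - m| - v *+ 2) ^+ 2 / (v *+ 4).
  by rewrite divr_ge0 ?sqr_ge0// mulrn_wge0// ltW.
have -> : (`|y - m| - v *+ 2) ^+ 2 / (v *+ 4) =
    (y - m) ^+ 2 / (v *+ 2 *+ 2) - `|y - m| + v.
  by rewrite sqrrB real_normK ?num_real//; field.
by rewrite mulNr; lra.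
Qed.

Lemma poly_gauss_density_le m v p : 0 < v ->
  exists2 C, 0 <= C &
    forall y, `|p.[y]| * gauss_density m v y <= C * gauss_density m (v *+ 2) y.
Proof.
move=> v0.
have /choice[C hC] : forall i, exists C, 0 <= C /\ forall y,
    `|y| ^+ i * gauss_density m v y <= C * gauss_density m (v *+ 2) y.
  by move=> i; have [C C0 hC] := exprn_gauss_density_le m i v0; exists C.
exists (\sum_(i < size p) `|p`_i| * C i).
  by apply: sumr_ge0 => i _; rewrite mulr_ge0//; case: (hC i).
move=> y; rewrite horner_coef mulr_suml.
apply: (le_trans (ler_wpM2r (gauss_density_ge0 m v y) (ler_norm_sum _ _ _))).
rewrite mulr_suml; apply: ler_sum => i _.
by rewrite normrM normrX -!mulrA ler_wpM2l//; case: (hC i).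
Qed.

Lemma measurable_horner p : measurable_fun setT (horner p).
Proof. by apply: continuous_measurable_fun; exact: continuous_horner. Qed.

Lemma integrable_poly_gauss m v p : 0 < v ->
  mu.-integrable setT (fun y => (p.[y] * gauss_density m v y)%:E).
Proof.
move=> v0; have [C C0 hC] := poly_gauss_density_le m p v0.
apply: le_integrable (integrableZl measurableT C (integrable_gauss_density m (v *+ 2))) => //.
  apply/measurable_EFinP; apply: measurable_funM.
    exact: measurable_horner.
  exact: measurable_gauss_density.
move=> y _ /=; rewrite lee_fin normrM (ger0_norm (gauss_density_ge0 _ _ _)).
by rewrite [leRHS]ger0_norm ?mulr_ge0 ?gauss_density_ge0.
Qed.

Lemma is_derive_gauss_density m v y : 0 < v ->
  is_derive y 1 (gauss_density m v) (- ((y - m) / v) * gauss_density m v y).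
Proof.
move=> v0; set c := (Num.sqrt (v * pi *+ 2))^-1.
pose q : {poly R} := - (v *+ 2)^-1 *: ('X - m%:P) ^+ 2.
have qE z : q.[z] = - (z - m) ^+ 2 / (v *+ 2).
  by rewrite /q hornerZ horner_exp hornerXsubC; ring.
have E : gauss_density m v = c *: (expR \o horner q).
  by apply/funext => z; rewrite gauss_densityE//= -qE.
have dq := is_derive_poly q y.
have de := @is_derive1_comp _ expR (horner q) y _ _ (is_derive_expR _) dq.
rewrite E; apply: trigger_derive (is_deriveZ c de) _.
rewrite [(c *: _) y]/(c *: expR q.[y]) /q derivZ deriv_exp derivXsubC mul1r expr1.
rewrite hornerZ hornerMn hornerXsubC.
set e := expR _.
change (c * (e * (- (v *+ 2)^-1 * ((y - m) *+ 2))) = - ((y - m) / v) * (c * e)).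
by field; rewrite gt_eqF.
Qed.

Lemma continuous_gauss_density m v : 0 < v -> continuous (gauss_density m v).
Proof.
by move=> v0; apply: continuous_normal_pdf; rewrite gt_eqF ?sqrtr_gt0.
Qed.

Lemma cvg_integral_itv (f : R -> R) : mu.-integrable setT (EFin \o f) ->
  (\int[mu]_(y in `[(- n.+1%:R)%R, n.+1%:R]) (f y)%:E)%E @[n --> \oo] -->
  (\int[mu]_y (f y)%:E)%E.
Proof.
move=> if_; pose D n := `[- n.+1%:R : R, n.+1%:R]%classic.
have mD n : measurable (D n : set (measurableTypeR R)) by exact: measurable_itv.
have mfD n : measurable_fun setT ((EFin \o f) \_ (D n)).
  apply/(measurable_restrictT _ (mD n)).
  by apply: measurable_funTS; exact: measurable_int if_.
have fD : {ae mu, forall y, setT y -> ((EFin \o f) \_ (D n)) y @[n --> \oo] --> (EFin \o f) y}.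
  apply: aeW => y _; apply: cvg_near_cst; near=> n.
  rewrite patchE mem_set// /D/= in_itv/= -ler_norml.
  have : (Num.bound `|y| <= n)%N by near: n; exact: nbhs_infty_ge.
  rewrite -(ler_nat R) => bn; rewrite (le_trans (ltW (archi_boundP (normr_ge0 y))))//.
  by rewrite (le_trans bn)// ler_nat.
have gD : {ae mu, forall y n, setT y -> (`|((EFin \o f) \_ (D n)) y| <= `|f y|%:E)%E}.
  by apply: aeW => y n _; rewrite patchE; case: ifP; rewrite ?abse0.
have ig : mu.-integrable setT (fun y => `|f y|%:E) := integrable_abse if_.
have [_ _] := @dominated_convergence _ (measurableTypeR R) R mu setT
  measurableT _ _ _ mfD (measurable_int mu if_) fD ig gD.
by under eq_fun do rewrite -integral_mkcond.
Unshelve. all: by end_near. Qed.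

Lemma stein_poly m v p : 0 < v ->
  \int[mu]_y ((p * ('X - m%:P)).[y] * gauss_density m v y) =
  v * \int[mu]_y (p^`().[y] * gauss_density m v y).
Proof.
move=> v0; have vn0 : v != 0 by rewrite gt_eqF.
pose F y := p.[y] * gauss_density m v y.
pose q := p^`() - v^-1 *: (p * ('X - m%:P)).
pose f y := q.[y] * gauss_density m v y.
have dF y : is_derive y 1 F (f y).
  have dg := is_derive_gauss_density m y v0.
  apply: trigger_derive (is_deriveM (is_derive_poly p y) dg) _.
  rewrite /f /q hornerD hornerN hornerZ hornerM hornerXsubC; set g := gauss_density _ _ _.
  by change (p.[y] * (- ((y - m) / v) * g) + g * p^`().[y] =
    (p^`().[y] - v^-1 * (p.[y] * (y - m))) * g); field.
have cF y : {for y, continuous F}.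
  by apply: differentiable_continuous; apply/derivable1_diffP; case: (dF y).
have cf : continuous f.
  by move=> y; apply: cvgM; [exact: continuous_horner|exact: continuous_gauss_density].
have if_ : mu.-integrable setT (EFin \o f) by exact: integrable_poly_gauss.
have f0 : \int[mu]_y f y = 0.
  have ftc n : (\int[mu]_(y in `[(- n.+1%:R)%R, n.+1%:R]) (f y)%:E =
      (F n.+1%:R - F (- n.+1%:R))%:E)%E.
    have n0 : (0 : R) < n.+1%:R by rewrite ltr0n.
    rewrite EFinB; apply: continuous_FTC2 => //.
    - by rewrite (lt_trans _ n0)// oppr_lt0.
    - exact: continuous_subspaceT.
    - split=> [y _||]; first by case: (dF y).
      + exact/cvg_at_right_filter/cF.
      + exact/cvg_at_left_filter/cF.
    - by move=> y _; rewrite derive1E; case: (dF y).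
  have [C C0 hC] := poly_gauss_density_le m (p * 'X) v0.
  pose K := C * normal_peak (Num.sqrt (v *+ 2)).
  have FK y : y != 0 -> `|F y| <= K / `|y|.
    move=> y0; rewrite ler_pdivlMr ?normr_gt0//.
    have := hC y; rewrite hornerMX normrM => h.
    rewrite /F normrM (ger0_norm (gauss_density_ge0 _ _ _)) mulrAC.
    apply: (le_trans h); rewrite ler_wpM2l//; apply: normal_pdf_ub.
    by rewrite gt_eqF// sqrtr_gt0 mulrn_wgt0.
  have F0 : F n.+1%:R - F (- n.+1%:R) @[n --> \oo] --> 0.
    have h0 : (K *+ 2) * n.+1%:R^-1 @[n --> \oo] --> 0.
      by rewrite -(mulr0 (K *+ 2)); apply: cvgMr; exact: cvg_harmonic.
    apply/norm_cvg0P; apply: squeeze_cvgr (cvg_cst 0) h0.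
    apply: nearW => n; rewrite normr_ge0/= (le_trans (ler_normB _ _))//.
    have n0 : n.+1%:R != 0 :> R by [].
    rewrite mulrnAl mulr2n lerD//.
      by have := FK _ n0; rewrite normr_nat.
    have : - n.+1%:R != 0 :> R by rewrite oppr_eq0.
    by move=> /FK; rewrite normrN normr_nat.
  have := cvg_integral_itv if_.
  under eq_fun do rewrite ftc.
  rewrite -(fineK (integrable_fin_num measurableT if_)) => h.
  exact: cvg_unique _ (fine_cvg h) F0.
have : \int[mu]_y f y = \int[mu]_y (p^`().[y] * gauss_density m v y) -
    v^-1 * \int[mu]_y ((p * ('X - m%:P)).[y] * gauss_density m v y).
  rewrite -RintegralZl ?integrable_poly_gauss// -RintegralB ?integrable_poly_gauss//.
    by apply: eq_Rintegral => y _; rewrite /f /q hornerD hornerN hornerZ; ring.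
  exact: (integrableZl measurableT v^-1 (integrable_poly_gauss m (p * ('X - m%:P)) v0)).
rewrite f0 => /esym/eqP; rewrite subr_eq0 => /eqP ->.
by rewrite mulrA divff// mul1r.
Qed.

Lemma gauss_moment_rec m v a (k : nat) : 0 < v ->
  \int[mu]_y ((a + y) ^+ k.+2 * gauss_density m v y) =
  (a + m) * \int[mu]_y ((a + y) ^+ k.+1 * gauss_density m v y) +
  v * k.+1%:R * \int[mu]_y ((a + y) ^+ k * gauss_density m v y).
Proof.
move=> v0; pose X := 'X + a%:P : {poly R}.
have XE (j : nat) y : (a + y) ^+ j = (X ^+ j).[y].
  by rewrite /X horner_exp hornerD hornerX hornerC addrC.
have := stein_poly m (X ^+ k.+1) v0.
have iX j := integrable_poly_gauss m (X ^+ j) v0.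
under eq_Rintegral => y _.
  have -> : (X ^+ k.+1 * ('X - m%:P)).[y] * gauss_density m v y =
    (a + y) ^+ k.+2 * gauss_density m v y -
    (a + m) * ((a + y) ^+ k.+1 * gauss_density m v y).
    by rewrite hornerM hornerXsubC -XE !exprS; ring.
  over.
rewrite RintegralB//=; last first.
  - apply: (eq_integrable measurableT) (integrableZl measurableT (a + m) (iX k.+1)) => y _.
    by rewrite /= -XE.
  - by apply: (eq_integrable measurableT) (iX k.+2) => y _; rewrite -XE.
rewrite RintegralZl//; last first.
  by apply: (eq_integrable measurableT) (iX k.+1) => y _; rewrite /= -XE.
move=> /eqP; rewrite subr_eq addrC => /eqP ->; congr (_ + _).
rewrite -mulrA; congr (_ * _); rewrite -RintegralZl//; last first.
  by apply: (eq_integrable measurableT) (iX k) => y _; rewrite /= -XE.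
apply: eq_Rintegral => y _.
rewrite deriv_exp derivD derivX derivC addr0 mul1r hornerMn -XE /=.
by rewrite mulrA mulr_natl.
Qed.

Lemma gauss_moment1 m v a : 0 < v ->
  \int[mu]_y ((a + y) * gauss_density m v y) = a + m.
Proof.
move=> v0; have := stein_poly m 1 v0.
rewrite derivC mul1r.
under [X in _ = v * X]eq_Rintegral do rewrite horner0 mul0r.
rewrite [X in _ = v * X]/Rintegral integral0 mulr0 => h.
have := integrable_poly_gauss m ('X - m%:P) v0 => i1.
rewrite -[RHS]add0r -h -[X in _ = _ + X]mulr1 -(integral_gauss_density m v).
rewrite -RintegralZl ?integrable_gauss_density// -RintegralD//.
  by apply: eq_Rintegral => y _; rewrite hornerXsubC; ring.
exact: (integrableZl measurableT (a + m) (integrable_gauss_density m v)).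
Qed.

End gauss_density_theory.

(* The moments of a Gaussian of mean [b] and variance [v], over an arbitrary ring
   so that they can be taken at polynomial [b] and [v]. *)
Fixpoint gauss_moment (A : comNzRingType) (b v : A) (k : nat) : A :=
  match k with
  | 0 => 1
  | j.+1 => match j with
            | 0 => b
            | i.+1 => b * gauss_moment b v j + v * j%:R * gauss_moment b v i
            end
  end.

Lemma nat_ind2 (P : nat -> Prop) :
  P 0%N -> P 1%N -> (forall k, P k -> P k.+1 -> P k.+2) -> forall k, P k.
Proof.
move=> P0 P1 PS k; suff: P k /\ P k.+1 by case.
by elim: k => [|k [Pk PkS]]; split=> //; exact: PS.
Qed.

Lemma integral_gauss_moment (R : realType) (a m v : R) (k : nat) : 0 < v ->
  \int[mu]_y ((a + y) ^+ k * gauss_density m v y) =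
  gauss_moment (a + m) v k.
Proof.
move=> v0; elim/nat_ind2: k => [||k IH0 IH1].
- by under eq_Rintegral do rewrite expr0 mul1r; exact: integral_gauss_density.
- by under eq_Rintegral do rewrite expr1; exact: gauss_moment1.
- by rewrite gauss_moment_rec// IH0 IH1.
Qed.

Lemma gauss_moment0 (A : comNzRingType) (b : A) (k : nat) :
  gauss_moment b 0 k = b ^+ k.
Proof.
elim/nat_ind2: k => [||k IH0 IH1]; rewrite ?expr0 ?expr1//.
rewrite [LHS]/= -/(gauss_moment b 0 k.+1).
by rewrite [X in b * X]IH1 !mul0r addr0 -exprS.
Qed.

Lemma gauss_moment_scale (A : comNzRingType) (c b v : A) (k : nat) :
  gauss_moment (c * b) (c ^+ 2 * v) k = c ^+ k * gauss_moment b v k.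
Proof.
elim/nat_ind2: k => [||k IH0 IH1]; rewrite ?expr0 ?expr1 ?mul1r//.
have E (x y : A) : gauss_moment x y k.+2 =
  x * gauss_moment x y k.+1 + y * k.+1%:R * gauss_moment x y k by [].
by rewrite !E IH0 IH1 !exprS; ring.
Qed.

Lemma horner_gauss_moment (A : comNzRingType) (b v : {poly A}) (k : nat) (x : A) :
  (gauss_moment b v k).[x] = gauss_moment b.[x] v.[x] k.
Proof.
elim/nat_ind2: k => [||k IH0 IH1]; first by rewrite /= hornerC.
  by [].
have E (B : comNzRingType) (y z : B) : gauss_moment y z k.+2 =
  y * gauss_moment y z k.+1 + z * k.+1%:R * gauss_moment y z k by [].
by rewrite !E hornerD !hornerM IH0 IH1 -polyC_natr hornerC.
Qed.

Section symmetric_truncation.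
Context (R : realType).
Implicit Types (m v y : R).

Lemma gauss_densityN m v y : 0 < v ->
  gauss_density m v (- y) = gauss_density (- m) v y.
Proof.
move=> v0; rewrite (gauss_densityE _ _ v0) (gauss_densityE (- m) _ v0).
by have -> : (- y - m) ^+ 2 = (y - - m) ^+ 2 by ring.
Qed.

Lemma gauss_density_le_sym m v y : 0 < v -> 0 <= m -> 0 <= y ->
  gauss_density (- m) v y <= gauss_density m v y.
Proof.
move=> v0 m0 y0; rewrite !gauss_densityE// ler_wpM2l ?invr_ge0//.
rewrite ler_expR ler_wpM2r ?invr_ge0 ?mulrn_wge0 ?(ltW v0)// lerN2.
rewrite -subr_ge0 opprK [leRHS](_ : _ = 4 * (m * y)); last by ring.
by rewrite !mulr_ge0.
Qed.

Lemma integrable_gauss_mean m v : 0 < v ->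
  mu.-integrable setT (fun y => (y * gauss_density m v y)%:E).
Proof.
move=> v0; have := integrable_poly_gauss m 'X v0.
by under eq_fun do rewrite hornerX.
Qed.

Context (A : set (measurableTypeR R)) (mA : measurable A)
  (NA : forall y, A (- y) = A y).

Lemma gauss_mean_symN m v : 0 < v ->
  \int[mu]_(y in A) (y * gauss_density m v y) =
  - \int[mu]_(y in A) (y * gauss_density (- m) v y).
Proof.
move=> v0; have i1 w := integrableS measurableT mA (@subsetT _ A) (integrable_gauss_mean w v0).
have preA : (-%R : measurableTypeR R -> measurableTypeR R) @^-1` A = A.
  by apply/seteqP; split=> y /=; rewrite NA.
transitivity (\int[mu]_(y in A) (- y * gauss_density (- m) v y)).
  rewrite /Rintegral; congr fine.
  pose h y := (y * gauss_density m v y)%:E.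
  have hN : h \o -%R = (fun y => (- y * gauss_density (- m) v y)%:E).
    by apply/funext => y; rewrite /h/= gauss_densityN.
  have hi : mu.-integrable (-%R @^-1` A) (h \o -%R).
    rewrite preA hN; apply: (eq_integrable mA) (integrableZl mA (-1) (i1 (- m))) => y _.
    by rewrite -EFinM mulN1r mulNr.
  have mh : measurable_fun setT h by exact: measurable_int (integrable_gauss_mean m v0).
  have := @integral_pushforward _ _ (measurableTypeR R) (measurableTypeR R) R -%R
    (@oppr_measurable R setT) mu A h mh hi mA.
  rewrite preA hN => <-; apply: eq_measure_integral => B mB _.
  by apply/esym/lebesgue_measureN.
rewrite -[RHS]mulN1r -RintegralZl ?(i1 (- m))//; apply: eq_Rintegral => y _.
by rewrite mulN1r mulNr.
Qed.

Lemma gauss_mean_sym_ge0 m v : 0 < v -> 0 <= m ->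
  0 <= \int[mu]_(y in A) (y * gauss_density m v y).
Proof.
move=> v0 m0; set J := Rintegral _ _ _.
have i1 w := integrableS measurableT mA (@subsetT _ A) (integrable_gauss_mean w v0).
suff: 0 <= J *+ 2 by rewrite pmulrn_lge0.
have -> : J *+ 2 = \int[mu]_(y in A)
    (y * gauss_density m v y - y * gauss_density (- m) v y).
  by rewrite RintegralB ?i1// mulr2n; congr (_ + _); exact: gauss_mean_symN.
apply: Rintegral_ge0 => y _; rewrite -mulrBr.
have [y0|y0] := leP 0 y.
  by rewrite mulr_ge0// subr_ge0 gauss_density_le_sym.
rewrite mulr_le0// ?(ltW y0)// subr_le0.
have Ny0 : 0 <= - y by rewrite oppr_ge0 ltW.
have := gauss_density_le_sym v0 m0 Ny0.
by rewrite (gauss_densityN (- m) _ v0) opprK (gauss_densityN m _ v0).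
Qed.

End symmetric_truncation.

Lemma gauss_mean_sym_le (R : realType) (A : set (measurableTypeR R)) (m v : R) :
  measurable A -> (forall y, A (- y) = A y) -> 0 < v ->
  `|\int[mu]_(y in A) (y * gauss_density m v y)| <= `|m|.
Proof.
move=> mA NA v0; wlog m0 : m / 0 <= m.
  move=> H; have [|m0] := leP 0 m; first exact: H.
  rewrite gauss_mean_symN// !normrN -(normrN m); apply: H.
  by rewrite oppr_ge0 ltW.
have mC := measurableC mA.
have NC y : (~` A) (- y) = (~` A) y by rewrite /setC/= NA.
have JA := gauss_mean_sym_ge0 mA NA v0 m0.
have JC := gauss_mean_sym_ge0 mC NC v0 m0.
have : m = \int[mu]_(y in A) (y * gauss_density m v y) +
   \int[mu]_(y in ~` A) (y * gauss_density m v y).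
  rewrite -Rintegral_setU//.
  - rewrite setUv -[LHS]add0r -(gauss_moment1 m 0 v0).
    by apply: eq_Rintegral => y _; rewrite add0r.
  - by rewrite setUv; exact: integrable_gauss_mean.
  - by rewrite disj_set2E setICr.
by move=> mE; rewrite !ger0_norm// {2}mE lerDl.
Qed.

Lemma ge0_integralZl_real (R : realType) (d : measure_display)
    (T : measurableType d) (nu : {measure set T -> \bar R}) (D : set T) (c : R)
    (k : T -> \bar R) :
  measurable D -> measurable_fun D k -> (forall w, D w -> 0 <= k w)%E ->
  (\int[nu]_(w in D) (c%:E * k w) = c%:E * \int[nu]_(w in D) k w)%E.
Proof.
move=> mD mk k0; have [c0|c0] := leP 0 c; first exact: ge0_integralZl_EFin.
have Nc0 : 0 <= - c by rewrite oppr_ge0 ltW.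
have -> : (\int[nu]_(w in D) (c%:E * k w) =
    \int[nu]_(w in D) - ((- c)%:E * k w))%E.
  by apply: eq_integral => w _; rewrite EFinN mulNe oppeK.
rewrite integral_ge0N; last by move=> w Dw; rewrite mule_ge0// ?lee_fin// k0.
by rewrite ge0_integralZl_EFin// EFinN mulNe oppeK.
Qed.

Lemma measurable_gauss_kernel (R : realType) (d : measure_display)
    (T : measurableType d) (D : set T) (b v z : T -> R) :
  measurable D -> measurable_fun D b -> measurable_fun D v ->
  measurable_fun D z -> (forall w, D w -> 0 < v w) ->
  measurable_fun D (fun w => gauss_density (b w) (v w) (z w)).
Proof.
move=> mD mb mv mz v0.
have mV (f : T -> R) : measurable_fun D f -> (forall w, D w -> 0 <= f w) ->
    measurable_fun D (fun w => (f w)^-1).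
  move=> mf f0; apply: (@eq_measurable_fun _ _ _ _ D (fun w => f w `^ (- 1))).
    by move=> w; rewrite inE => Dw; rewrite powR_inv1// f0.
  by apply: (measurableT_comp (measurable_powR (-1))).
apply: (@eq_measurable_fun _ _ _ _ D (fun w => (Num.sqrt (v w * pi *+ 2))^-1 *
    expR (- (z w - b w) ^+ 2 / (v w *+ 2)))).
  by move=> w; rewrite inE => Dw; rewrite gauss_densityE// v0.
have m2 (f : T -> R) : measurable_fun D f -> measurable_fun D (fun w => f w *+ 2).
  by move=> mf; under eq_fun do rewrite mulr2n; exact: measurable_funD.
apply: measurable_funM.
  apply: mV => [|w _]; last exact: sqrtr_ge0.
  apply: (measurableT_comp (continuous_measurable_fun (@sqrt_continuous R))).
  by apply: m2; exact: measurable_funM.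
apply: (measurableT_comp (@measurable_expR R)); apply: measurable_funM.
  apply: (measurableT_comp (@oppr_measurable R setT)).
  by apply: measurable_funX; exact: measurable_funB.
by apply: mV => [|w /v0 vw]; [exact: m2|rewrite mulrn_wge0// ltW].
Qed.

Lemma gauss_mixture_fubini (R : realType)
    (nu : {sigma_finite_measure set (measurableTypeR R) -> \bar R})
    (D A : set (measurableTypeR R)) (b v h : R -> R) (C : R -> \bar R) :
  measurable D -> measurable A ->
  measurable_fun D b -> measurable_fun D v -> (forall w, D w -> 0 < v w) ->
  measurable_fun A h ->
  nu.-integrable D C ->
  (forall w, D w ->
    (\int[mu]_(y in A) (`|h y| * gauss_density (b w) (v w) y)%:E <= C w)%E) ->
  let g y := ((h y)%:E * \int[nu]_(w in D) (gauss_density (b w) (v w) y)%:E)%E in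
  let e w := (\int[mu]_(y in A) (h y * gauss_density (b w) (v w) y)%:E)%E in
  [/\ mu.-integrable A g, nu.-integrable D e &
      (\int[mu]_(y in A) g y = \int[nu]_(w in D) e w)%E].
Proof.
move=> mD mA mb mv v0 mh iC hC g e.
pose k (p : measurableTypeR R * measurableTypeR R) :=
  gauss_density (b p.2) (v p.2) p.1.
have mAD : measurable (A `*` D) by exact: measurableX.
pose F := (fun p : measurableTypeR R * measurableTypeR R =>
  (h p.1 * k p)%:E) \_ (A `*` D).
have mF : measurable_fun setT F.
  apply/(measurable_restrictT _ mAD)/measurable_EFinP; apply: measurable_funM.
    apply: (@measurable_comp _ _ _ _ _ _ A h (A `*` D) fst) => //.
      by move=> _ [[y w] [/= Ay _] <-].
    exact: measurable_funTS.
  have msnd (u : R -> R) : measurable_fun D u ->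
      measurable_fun (A `*` D) (fun p : measurableTypeR R * measurableTypeR R => u p.2).
    move=> mu_; apply: (@measurable_comp _ _ _ _ _ _ D u (A `*` D) snd) => //.
      by move=> _ [[y w] [/= _ Dw] <-].
    exact: measurable_funTS.
  apply: measurable_gauss_kernel => //; [exact: msnd|exact: msnd| |].
    exact: measurable_funTS.
  by move=> [y w] [_ /=]; exact: v0.
have F2 y w : F (y, w) =
    ((fun w' => (\1_A y * h y)%:E * (gauss_density (b w') (v w') y)%:E) \_ D)%E w.
  rewrite /F !patchE in_setX /= indicE -EFinM.
  by case: (y \in A); case: (w \in D); rewrite //= ?mul1r// !mul0r.
have F1 y w : F (y, w) =
    ((fun y' => (\1_D w * (h y' * gauss_density (b w) (v w) y'))%:E) \_ A)%E y.
  rewrite /F !patchE in_setX /= indicE.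
  by case: (y \in A); case: (w \in D); rewrite //= ?mul1r// !mul0r.
have mk y : measurable_fun D (fun w => (gauss_density (b w) (v w) y)%:E).
  by apply/measurable_EFinP; apply: measurable_gauss_kernel.
have intF2 y : (\int[nu]_w F (y, w) = (g \_ A) y)%E.
  under eq_integral do rewrite F2.
  rewrite -integral_mkcond ge0_integralZl_real//; last first.
    by move=> w _; rewrite lee_fin gauss_density_ge0.
  by rewrite patchE indicE /g; case: (y \in A); rewrite ?mul1r// mul0r mul0e.
have intF1 w : (\int[mu]_y F (y, w) =
    (e \_ D) w)%E.
  under eq_integral do rewrite F1.
  rewrite -integral_mkcond patchE indicE; case: (w \in D).
    by rewrite /e; apply: eq_integral => y _; rewrite mul1r.
  by rewrite integral0_eq// => y _; rewrite mul0r.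
have absF1 w : (\int[mu]_y `|F (y, w)| =
    ((fun w' => \int[mu]_(y in A) (`|h y| * gauss_density (b w') (v w') y)%:E) \_ D) w)%E.
  transitivity (\int[mu]_y
      ((fun y' => (\1_D w * (`|h y'| * gauss_density (b w) (v w) y'))%:E) \_ A) y)%E.
    apply: eq_integral => y _; rewrite F1 !patchE; case: ifP => _; rewrite ?abse0//=.
    by rewrite !normrM ger0_norm// (ger0_norm (gauss_density_ge0 _ _ _)).
  rewrite -integral_mkcond patchE indicE; case: (w \in D).
    by apply: eq_integral => y _; rewrite mul1r.
  by rewrite integral0_eq// => y _; rewrite mul0r.
pose a w := (\int[mu]_(y in A) (`|h y| * gauss_density (b w) (v w) y)%:E)%E.
have a0 w : (0 <= a w)%E.
  by apply: integral_ge0 => y _; rewrite lee_fin mulr_ge0 ?gauss_density_ge0.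
have maF : measurable_fun setT (abse \o F) by exact: measurableT_comp.
have mabs := @measurable_fun_fubini_tonelli_G _ _ _ _ _ mu (abse \o F) maF (fun=> abse_ge0 _).
have ma : measurable_fun D a.
  apply/(measurable_restrictT _ mD); apply: eq_measurable_fun mabs => w _.
  exact: absF1.
have hfin : (\int[nu]_(w in D) a w < +oo)%E.
  have /integrableP[mC] := iC; apply: le_lt_trans; apply: ge0_le_integral => //.
    exact: measurableT_comp.
  by move=> w Dw; apply: (le_trans (hC w Dw)); exact: lee_abs.
have iF : (mu \x nu)%E.-integrable setT F.
  apply/integrable21ltyP => //.
  by under eq_integral do rewrite absF1; rewrite -integral_mkcond.
split.
  apply/(integrable_mkcond _ mA).
  rewrite (_ : g \_ A = fubini_F nu F); last by apply/funext => y; rewrite -intF2.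
  exact: integrable_fubini_F.
  apply/(integrable_mkcond _ mD).
  rewrite (_ : e \_ D = fubini_G mu F); last by apply/funext => w; rewrite -intF1.
  have mG : measurable_fun setT (fubini_G mu F) := measurable_fubini_G iF.
  apply/integrableP; split=> //.
  have hfin' : (\int[nu]_w \int[mu]_y `|F (y, w)| < +oo)%E.
    by under eq_integral do rewrite absF1; rewrite -integral_mkcond.
  have mF1 w : measurable_fun setT (fun y => F (y, w)).
    exact: measurableT_comp mF (pair2_measurable w).
  apply: le_lt_trans hfin'; apply: ge0_le_integral => //.
  - exact: measurableT_comp.

  - by move=> w _; exact: le_abse_integral.
rewrite [LHS]integral_mkcond [RHS]integral_mkcond.
under eq_integral do rewrite -intF2.
by under [RHS]eq_integral do rewrite -intF1; exact: Fubini.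
Qed.

(** * The jump integral *)

Local Opaque gauss_density.

Lemma levy_sigma_finite (R : realType)
    (nu : {measure set (measurableTypeR R) -> \bar R}) :
  nu (~` `[0, +oo[%classic) = 0%E -> nu [set 0] = 0%E ->
  (\int[nu]_(w in `[0%R, +oo[) (Num.min 1 w)%:E < +oo)%E ->
  sigma_finite setT nu.
Proof.
move=> nuC nu0 numin.
have c0 n : (0 : R) < n.+1%:R^-1 by rewrite invr_gt0 ltr0n.
pose F n : set (measurableTypeR R) :=
  (~` `[0, +oo[%classic) `|` [set 0] `|` `[n.+1%:R^-1, +oo[%classic.
have mC : measurable (~` `[0%R, +oo[%classic : set (measurableTypeR R)).
  by apply: measurableC; exact: measurable_itv.
have m0 : measurable ([set 0%R] : set (measurableTypeR R)) by exact: measurable_set1.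
have mI n : measurable (`[n.+1%:R^-1, +oo[%classic : set (measurableTypeR R)).
  exact: measurable_itv.
exists F.
  apply/seteqP; split=> // w _.
  have [w0|w0|w0] := ltgtP w 0.
  - by exists 0%N => //; left; left => /=; rewrite in_itv/= andbT; apply/negP; rewrite -ltNge.
  - exists (Num.bound w^-1) => //; right => /=; rewrite in_itv/= andbT.
    rewrite -[leRHS]invrK lef_pV2 ?posrE ?invr_gt0//.
    apply: (le_trans (ltW (archi_boundP _))); first by rewrite invr_ge0 ltW.
    by rewrite ler_nat.
  - by exists 0%N => //; left; right.
move=> n; split; first by apply: measurableU => //; exact: measurableU.
pose c : R := n.+1%:R^-1.
have finI : (nu `[c, +oo[%classic < +oo)%E.
  have mIc : measurable (`[c, +oo[%classic : set (measurableTypeR R)) := mI n.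
  have sub : `[c, +oo[%classic `<=` `[0%R, +oo[%classic.
    by move=> w /=; rewrite !in_itv/= !andbT; apply: le_trans; exact: ltW (c0 n).
  have mm : measurable_fun (`[0%R, +oo[%classic : set R) (fun w : R => (Num.min 1 w)%:E).
    by apply/measurable_EFinP; apply: measurable_minr.
  rewrite -[X in (X < _)%E]mul1e -integral_cst//.
  apply: (@le_lt_trans _ _ (\int[nu]_(w in `[c, +oo[) ((n.+1%:R)%:E * (Num.min 1 w)%:E))%E).
    apply: ge0_le_integral => //.
    - by apply: measurable_funeM; exact: measurable_funS mm.
    - move=> w /=; rewrite in_itv/= andbT => wn.
      rewrite -EFinM lee_fin -ler_pdivrMl// mulr1 le_min wn invf_le1// ?ler1n//.
  rewrite ge0_integralZl_real//; last 2 first.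
  - exact: measurable_funS mm.
  - by move=> w /sub/=; rewrite in_itv/= andbT lee_fin le_min ler01.
  apply: lte_mul_pinfty => //.
  apply: le_lt_trans numin; apply: ge0_subset_integral => //.
  by move=> w /=; rewrite in_itv/= andbT lee_fin le_min ler01.
apply: le_lt_trans (measureU2 _ _ _) _ => //; first exact: measurableU.
rewrite lte_add_pinfty//; apply: le_lt_trans (measureU2 _ _ _) _ => //.
by apply: lte_add_pinfty; [rewrite [ltLHS]nuC|rewrite [ltLHS]nu0].
Qed.

Lemma horner_le_sum (R : realType) (Q : {poly R}) (t : R) : 0 <= t <= 1 ->
  `|Q.[t]| <= \sum_(i < size Q) `|Q`_i|.
Proof.
move=> /andP[t0 t1]; rewrite horner_coef.
apply: (le_trans (ler_norm_sum _ _ _)); apply: ler_sum => i _.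
by rewrite normrM ler_piMr// normrX exprn_ile1// ger0_norm.
Qed.

Lemma horner_le_onem (R : realType) (Q : {poly R}) : Q.[1] = 0 ->
  exists2 C, 0 <= C & forall t, 0 <= t <= 1 -> `|Q.[t]| <= C * (1 - t).
Proof.
move=> Q1; have /factor_theorem[P ->] : root Q 1 by apply/rootP.
exists (\sum_(i < size P) `|P`_i|); first exact: sumr_ge0.
move=> t t01; have /andP[_ t1] := t01.
rewrite hornerM hornerXsubC normrM distrC (ger0_norm (_ : 0 <= 1 - t)) ?subr_ge0//.
by rewrite ler_wpM2r ?subr_ge0// horner_le_sum.
Qed.

Lemma onem_expR_le_min (R : realType) (w : R) : 0 <= w ->
  1 - expR (- (w / 2)) <= Num.min 1 w.
Proof.
move=> w0; rewrite le_min lerBlDr lerDl expR_ge0/=.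
by have := expR_ge1Dx (- (w / 2)); lra.
Qed.

Lemma measurable_expRN2 (R : realType) (Q : {poly R}) :
  measurable_fun setT (fun w : R => Q.[expR (- (w / 2))]).
Proof.
apply: (measurableT_comp (measurable_horner Q)).
apply: (measurableT_comp (@measurable_expR R)).
apply: (measurableT_comp (@oppr_measurable R setT)).
exact: measurable_funM.
Qed.

Lemma gauss_poly_expectation (R : realType) (p : {poly R}) (x s : R) : 0 < s ->
  exists Q : {poly R}, Q.[1] = p.[0] /\ forall t, 0 <= t < 1 ->
   \int[mu]_y (p.[y] * gauss_density ((t - 1) * x) (s * (1 - t ^+ 2)) y) = Q.[t].
Proof.
move=> s0; pose b : {poly R} := ('X - 1) * x%:P; pose v : {poly R} := s%:P * (1 - 'X^2).
have bE t : b.[t] = (t - 1) * x by rewrite /b !hornerE.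
have vE t : v.[t] = s * (1 - t ^+ 2) by rewrite /v !hornerE.
exists (\sum_(i < size p) (p`_i)%:P * gauss_moment b v i); split.
  rewrite horner_sum horner_coef; apply: eq_bigr => i _.
  rewrite hornerM hornerC horner_gauss_moment bE vE expr1n !subrr mulr0 mul0r.
  by rewrite gauss_moment0.
move=> t /andP[t0 t1]; set m := _ * x; set w := s * _.
have w0 : 0 < w by rewrite mulr_gt0// subr_gt0 expr_lt1.
have ii (i : nat) := integrable_poly_gauss m ('X^i) w0.
transitivity (\int[mu]_y (\sum_(i < size p) p`_i * ('X^i.[y] * gauss_density m w y))).
  apply: eq_Rintegral => y _; rewrite horner_coef mulr_suml.
  by apply: eq_bigr => i _; rewrite hornerXn mulrA.
rewrite /Rintegral; under eq_integral do rewrite -sumEFin.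
rewrite integral_sum//; last first.
  by move=> i; exact: (integrableZl measurableT p`_i (ii i)).
rewrite -sum_fine//; last first.
  move=> i _; apply: integrable_fin_num => //.
  exact: (integrableZl measurableT p`_i (ii i)).
rewrite horner_sum; apply: eq_bigr => i _.
transitivity (\int[mu]_y (p`_i * ('X^i.[y] * gauss_density m w y))) => //.
rewrite RintegralZl ?ii// hornerM hornerC horner_gauss_moment bE vE -/m -/w.
congr (_ * _); rewrite -[m in RHS]add0r -integral_gauss_moment//.
by apply: eq_Rintegral => y _; rewrite hornerXn add0r.
Qed.

Definition jump_gauss (R : realType) (x s w y : R) : R :=
  gauss_density ((expR (- (w / 2)) - 1) * x) (s * (1 - expR (- w))) y.

Lemma jump_var_gt0 (R : realType) (s w : R) : 0 < s -> 0 < w ->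
  0 < s * (1 - expR (- w)).
Proof. by move=> s0 w0; rewrite mulr_gt0// subr_gt0 expR_lt1 oppr_lt0. Qed.

Lemma jump_poly_expectation (R : realType) (p : {poly R}) (x s : R) : 0 < s ->
  exists Q : {poly R}, Q.[1] = p.[0] /\ forall w, 0 < w ->
   \int[mu]_y (p.[y] * jump_gauss x s w y) = Q.[expR (- (w / 2))].
Proof.
move=> s0; have [Q [Q1 QE]] := gauss_poly_expectation p x s0.
exists Q; split=> // w w0.
have t01 : 0 <= expR (- (w / 2)) < 1.
  by rewrite expR_ge0 expR_lt1 oppr_lt0 divr_gt0.
rewrite -(QE _ t01).
have E : expR (- (w / 2)) ^+ 2 = expR (- w) by rewrite expr2 -expRD; congr expR; field.
by rewrite E.
Qed.

Lemma levy_integrable_min (R : realType)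
    (nu : {measure set (measurableTypeR R) -> \bar R}) :
  (\int[nu]_(w in `[0%R, +oo[) (Num.min 1 w)%:E < +oo)%E ->
  nu.-integrable `[0%R, +oo[ (fun w : R => (Num.min 1 w)%:E).
Proof.
move=> numin.
have mmin : measurable_fun (`[0%R, +oo[%classic : set (measurableTypeR R))
    (fun w : R => (Num.min 1 w)%:E).
  by apply/measurable_EFinP; apply: measurable_minr.
apply/integrableP; split=> //; apply: le_lt_trans numin.
apply: ge0_le_integral => //; first exact: measurableT_comp.
move=> w /=; rewrite in_itv/= andbT => w0.
by rewrite ger0_norm// le_min ler01.
Qed.

Lemma levy_integrable_poly (R : realType)
    (nu : {measure set (measurableTypeR R) -> \bar R}) (Q : {poly R}) :
  (\int[nu]_(w in `[0%R, +oo[) (Num.min 1 w)%:E < +oo)%E -> Q.[1] = 0 ->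
  nu.-integrable `[0%R, +oo[ (fun w => (Q.[expR (- (w / 2))])%:E).
Proof.
move=> numin Q1; have [C C0 hC] := horner_le_onem Q1.
have mI : measurable (`[0%R, +oo[%classic : set (measurableTypeR R)).
  exact: measurable_itv.
have imin := levy_integrable_min numin.
apply: le_integrable (integrableZl mI C imin) => //.
  apply/measurable_EFinP; apply: measurable_funTS; exact: measurable_expRN2.
move=> w; rewrite /= in_itv/= andbT => w0; rewrite lee_fin.
rewrite [leRHS]ger0_norm ?mulr_ge0 ?le_min ?ler01//.
have t01 : 0 <= expR (- (w / 2)) <= 1.
  by rewrite expR_ge0 -expR0 ler_expR oppr_le0 divr_ge0.
by apply: (le_trans (hC _ t01)); rewrite ler_wpM2l// onem_expR_le_min.
Qed.

Lemma ge0_integral_levy0 (R : realType)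
    (nu : {measure set (measurableTypeR R) -> \bar R}) (f : R -> R) :
  nu [set 0] = 0%E -> measurable_fun (`]0, +oo[%classic : set R) f -> (forall w, 0 <= f w) ->
  (\int[nu]_(w in `[0%R, +oo[) (f w)%:E = \int[nu]_(w in `]0%R, +oo[) (f w)%:E)%E.
Proof.
move=> nu0 /measurable_fun_itv_obnd_cbndP mf f0.
rewrite (@ge0_negligible_integral _ _ _ nu _ [set 0])//.
- by rewrite setDitv1l.
- exact/measurable_EFinP.
- by move=> w _; rewrite lee_fin.
Qed.

Lemma integral_levy0 (R : realType)
    (nu : {measure set (measurableTypeR R) -> \bar R}) (f : R -> \bar R) :
  nu [set 0] = 0%E -> nu.-integrable `[0%R, +oo[ f ->
  (\int[nu]_(w in `[0%R, +oo[) f w = \int[nu]_(w in `]0%R, +oo[) f w)%E.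
Proof.
move=> nu0 intf; rewrite (@negligible_integral _ _ _ nu _ [set 0%R])//.
by rewrite setDitv1l.
Qed.

Lemma poly_quadratic_le (R : realType) (P : {poly R}) (y : R) : P.[0] = 0 ->
  `|P.[y] - P`_1 * y| <= ('X^2 * (1 + drop_poly 2 P ^+ 2)).[y].
Proof.
move=> P0; rewrite -{1}(poly_take_drop 2 P) hornerD hornerM hornerXn.
have -> : (take_poly 2 P).[y] = P`_1 * y.
  rewrite /take_poly horner_poly !big_ord_recr big_ord0 /= expr0 expr1.
  by rewrite -horner_coef0 P0 mul0r !add0r.
rewrite addrAC subrr add0r !hornerE/=.
set d := (drop_poly 2 P).[y]; rewrite -mulrA -expr2 normrM normrX mulrC real_normK ?num_real//.
rewrite ler_wpM2l ?sqr_ge0//.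
have : 0 <= (`|d| - 1 / 2) ^+ 2 by exact: sqr_ge0.
rewrite -(real_normK (num_real d)); set a := `|d|; nra.
Qed.

Lemma measurable_jump_params (R : realType) (x s : R) :
  measurable_fun setT (fun w : R => (expR (- (w / 2)) - 1) * x) /\
  measurable_fun setT (fun w : R => s * (1 - expR (- w))).
Proof.
have me (c : R) : measurable_fun setT (fun w : R => expR (- (w * c))).
  apply: (measurableT_comp (@measurable_expR R)).
  apply: (measurableT_comp (@oppr_measurable R setT)).
  exact: measurable_funM.
split; apply: measurable_funM => //.
  by apply: measurable_funB => //; exact: me.
apply: measurable_funB => //; have := me 1.
by under eq_fun do rewrite mulr1.
Qed.

Lemma measurable_abs_gt (R : realType) (e : R) :
  measurable ([set y | e < `|y|] : set (measurableTypeR R)).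
Proof.
have -> : [set y : R | e < `|y|] = setT `&` (@Num.norm _ R @^-1` `]e, +oo[%classic).
  by rewrite setTI; apply/seteqP; split=> y /=; rewrite in_itv/= andbT.
by apply: (@normr_measurable R setT) => //; exact: measurable_itv.
Qed.

Lemma integrable_jump_poly (R : realType) (p : {poly R}) (x s w : R) :
  0 < s -> 0 < w -> mu.-integrable setT (fun y => (p.[y] * jump_gauss x s w y)%:E).
Proof.
by move=> s0 w0; apply: integrable_poly_gauss; exact: jump_var_gt0.
Qed.

Lemma jump_truncated_bound (R : realType) (P : {poly R}) (x s : R) :
  0 < s -> P.[0] = 0 ->
  (forall e : R, 0 < e -> exists2 C : R, 0 <= C & forall w : R, 0 < w ->
     \int[mu]_(y in [set y | e < `|y|]) (`|P.[y]| * jump_gauss x s w y) <=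
     C * Num.min 1 w) /\
  (exists2 C : R, 0 <= C & forall e w : R, 0 < w ->
     `|\int[mu]_(y in [set y | e < `|y|]) (P.[y] * jump_gauss x s w y)| <=
     C * Num.min 1 w).
Proof.
move=> s0 P0; set W := 'X^2 * (1 + drop_poly 2 P ^+ 2).
have W0 (y : R) : 0 <= W.[y].
  by rewrite /W !hornerE/= mulr_ge0 ?sqr_ge0// addr_ge0 ?sqr_ge0.
have y2W (y : R) : y ^+ 2 <= W.[y].
  by rewrite /W !hornerE/= ler_peMr ?sqr_ge0// lerDl sqr_ge0.
have [Q [Q1 QE]] := jump_poly_expectation W x s0.
have Q10 : Q.[1] = 0 by rewrite Q1 /W hornerM hornerXn expr0n mul0r.
have [C C0 hC] := horner_le_onem Q10.
have QW (w : R) : 0 < w -> \int[mu]_y (W.[y] * jump_gauss x s w y) <= C * Num.min 1 w.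
  move=> w0; rewrite QE//; apply: (le_trans (ler_norm _)).
  have t01 : 0 <= expR (- (w / 2)) <= 1.
    by rewrite expR_ge0 ltW// expR_lt1 oppr_lt0 divr_gt0.
  apply: (le_trans (hC _ t01)); rewrite ler_wpM2l// onem_expR_le_min//.
  exact: ltW.
have g0 (w y : R) : 0 <= jump_gauss x s w y by exact: gauss_density_ge0.
have mA (e : R) := measurable_abs_gt e.
have iA p (e w : R) : 0 < w -> mu.-integrable [set y | e < `|y|]
    (fun y => (p.[y] * jump_gauss x s w y)%:E).
  by move=> w0; apply: (integrableS measurableT) => //; exact: integrable_jump_poly.
have WA (e w : R) : 0 < w ->
    \int[mu]_(y in [set y | e < `|y|]) (W.[y] * jump_gauss x s w y) <=
    \int[mu]_y (W.[y] * jump_gauss x s w y).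
  move=> w0; rewrite /Rintegral fine_le//.
  - by apply: integrable_fin_num => //; exact: iA.
  - by apply: integrable_fin_num => //; exact: integrable_jump_poly.
  - apply: ge0_subset_integral => //.
      by apply: (measurable_int mu); exact: integrable_jump_poly.
    by move=> y _; rewrite lee_fin mulr_ge0.
split.
  move=> e e0; pose K := `|P`_1| / e + 1.
  have K0 : 0 <= K by rewrite addr_ge0// divr_ge0// ltW.
  exists (K * C) => [|w w0]; first exact: mulr_ge0.
  have PK (y : R) : e < `|y| -> `|P.[y]| <= K * W.[y].
    move=> ey; rewrite -(subrK (P`_1 * y) P.[y]).
    apply: (le_trans (ler_normD _ _)); rewrite mulrDl mul1r addrC lerD//.
      rewrite normrM -mulrA ler_wpM2l// ler_pdivlMl//.
      apply: le_trans (y2W y); rewrite -(real_normK (num_real y)) expr2.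
      by rewrite ler_wpM2r// ltW.
    exact: poly_quadratic_le.
  apply: (@le_trans _ _ (\int[mu]_(y in [set y | e < `|y|]) (K * (W.[y] * jump_gauss x s w y)))).
    apply: le_Rintegral => //.
    - apply: eq_integrable (integrable_abse (iA P e w w0)) => // y _.
      by rewrite /= normrM (ger0_norm (g0 _ _)).
    - apply: eq_integrable (integrableZl (mA e) K (iA W e w w0)) => //.
    - by move=> y /= ey; rewrite mulrA ler_wpM2r// PK.
  rewrite RintegralZl//; last exact: iA.
  rewrite -mulrA ler_wpM2l//; apply: le_trans (QW _ w0); exact: WA.
exists (`|P`_1| * `|x| + C) => [|e w w0]; first by rewrite addr_ge0// mulr_ge0.
have iX : mu.-integrable [set y | e < `|y|]
    (fun y => (P`_1 * (y * jump_gauss x s w y))%:E).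
  apply: eq_integrable (iA (P`_1 *: 'X) e w w0) => // y _.
  by rewrite hornerZ hornerX mulrA.
have iX1 : mu.-integrable [set y | e < `|y|] (fun y => (y * jump_gauss x s w y)%:E).
  by apply: eq_integrable (iA 'X e w w0) => // y _; rewrite hornerX.
have iD : mu.-integrable [set y | e < `|y|]
    (fun y => ((P.[y] - P`_1 * y) * jump_gauss x s w y)%:E).
  apply: eq_integrable (iA (P - P`_1 *: 'X) e w w0) => // y _.
  by rewrite hornerD hornerN hornerZ hornerX.
have -> : \int[mu]_(y in [set y | e < `|y|]) (P.[y] * jump_gauss x s w y) =
    P`_1 * (\int[mu]_(y in [set y | e < `|y|]) (y * jump_gauss x s w y)) +
    \int[mu]_(y in [set y | e < `|y|]) ((P.[y] - P`_1 * y) * jump_gauss x s w y).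
  rewrite -RintegralZl// -RintegralD//.
  by apply: eq_Rintegral => y _; ring.
apply: (le_trans (ler_normD _ _)); rewrite mulrDl lerD//.
  rewrite normrM -mulrA ler_wpM2l//.
  apply: (le_trans (gauss_mean_sym_le _ (mA e) _ (jump_var_gt0 s0 w0))).
    by move=> y /=; rewrite normrN.
  rewrite normrM mulrC ler_wpM2l// distrC ger0_norm.
    exact: onem_expR_le_min (ltW w0).
  by rewrite subr_ge0 ltW// expR_lt1 oppr_lt0 divr_gt0.
apply: (le_trans (le_normr_Rintegral (mA e) iD)).
apply: le_trans (QW _ w0); apply: le_trans (WA e _ w0).
apply: le_Rintegral => //.
- exact: integrable_abse iD.
- exact: iA.
- move=> y _; rewrite normrM (ger0_norm (g0 _ _)) ler_wpM2r//.
  exact: poly_quadratic_le.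
Qed.

(* A copy of [nu] whose sigma-finiteness is available to type inference. *)
Definition sigma_finite_of (d : measure_display) (T : measurableType d)
    (R : realType) (nu : {measure set T -> \bar R})
    of sigma_finite setT nu : set T -> \bar R := nu.

HB.instance Definition _ (d : measure_display) (T : measurableType d)
    (R : realType) (nu : {measure set T -> \bar R}) (sf : sigma_finite setT nu) :=
  Measure.copy (sigma_finite_of sf) nu.

HB.instance Definition _ (d : measure_display) (T : measurableType d)
    (R : realType) (nu : {measure set T -> \bar R}) (sf : sigma_finite setT nu) :=
  @Measure_isSigmaFinite.Build d T R (sigma_finite_of sf) sf.

Lemma jump_integral (R : realType)
    (nu : {measure set (measurableTypeR R) -> \bar R}) (P Q : {poly R}) (x s : R) :
  0 < s -> nu (~` `[0, +oo[%classic) = 0%E -> nu [set 0] = 0%E ->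
  (\int[nu]_(w in `[0%R, +oo[) (Num.min 1 w)%:E < +oo)%E ->
  P.[0] = 0 -> Q.[1] = 0 ->
  (forall w : R, 0 < w ->
     \int[mu]_y (P.[y] * jump_gauss x s w y) = Q.[expR (- (w / 2))]) ->
  is_integral_off0 (fun y => P.[y]%:E * jump_density nu s x y)%E
    (\int[nu]_(w in `[0, +oo[) Q.[expR (- (w / 2))]).
Proof.
move=> s0 nuC nu0 numin P0 Q1 QE.
have [bnd [C C0 hC]] := jump_truncated_bound x s0 P0.
have [mb mv] := measurable_jump_params x s.
pose D : set (measurableTypeR R) := `]0, +oo[%classic.
have mD : measurable D by exact: measurable_itv.
have mI : measurable (`[0%R, +oo[%classic : set (measurableTypeR R)).
  exact: measurable_itv.
have DI : D `<=` `[0%R, +oo[%classic.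
  by apply: subset_itvr; rewrite bnd_simp.
have Dgt0 w : D w -> 0 < w by rewrite /D/= in_itv/= andbT.
have v0 w : D w -> 0 < s * (1 - expR (- w)) by move=> /Dgt0; exact: jump_var_gt0.
have imin := integrableS mI mD DI (levy_integrable_min numin).
have sf := levy_sigma_finite nuC nu0 numin.
have mA (e : R) := measurable_abs_gt e.
have iA (e w : R) : 0 < w -> mu.-integrable [set y | e < `|y|]
    (fun y => (P.[y] * jump_gauss x s w y)%:E).
  by move=> w0; apply: (integrableS measurableT) => //; exact: integrable_jump_poly.
pose J (e w : R) := \int[mu]_(y in [set y | e < `|y|]) (P.[y] * jump_gauss x s w y).
have JE (e w : R) : 0 < w ->
    (\int[mu]_(y in [set y | (e < `|y|)%R]) (P.[y] * jump_gauss x s w y)%:E = (J e w)%:E)%E.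
  by move=> w0; rewrite /J /Rintegral fineK//; apply: integrable_fin_num => //; exact: iA.
have mix (e : R) : 0 < e ->
  [/\ mu.-integrable [set y | e < `|y|] (fun y => P.[y]%:E * jump_density nu s x y)%E,
     nu.-integrable D (fun w => (J e w)%:E) &
     (\int[mu]_(y in [set y | (e < `|y|)%R]) (P.[y]%:E * jump_density nu s x y) =
      \int[nu]_(w in D) (J e w)%:E)%E].
  move=> e0; have [K K0 hK] := bnd e e0.
  have mP : measurable_fun ([set y | e < `|y|] : set (measurableTypeR R)) (horner P).
    by apply: measurable_funTS; exact: measurable_horner.
  have iKmin : nu.-integrable D (fun w => (K * Num.min 1 w)%:E).
    exact: (integrableZl mD K imin).
  have hKmin w : D w -> (\int[mu]_(y in [set y | (e < `|y|)%R])
      (`|P.[y]| * gauss_density ((expR (- (w / 2)) - 1) * x)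
        (s * (1 - expR (- w))) y)%:E <= (K * Num.min 1 w)%:E)%E.
    move=> /Dgt0 w0; rewrite -[leLHS]fineK ?lee_fin; first exact: hK.
    apply: integrable_fin_num => //.
    apply: eq_integrable (integrable_abse (iA e w w0)) => // y _.
    by rewrite /= normrM (ger0_norm (gauss_density_ge0 _ _ _)).
  have [i1 i2 i3] := @gauss_mixture_fubini R (sigma_finite_of sf) D
    [set y | e < `|y|] _ _ (horner P) _ mD (mA e) (measurable_funTS mb)
    (measurable_funTS mv) v0 mP iKmin hKmin.
  have jE y : jump_density nu s x y =
    (\int[sigma_finite_of sf]_(w in D) (gauss_density ((expR (- (w / 2)) - 1) * x)
      (s * (1 - expR (- w))) y)%:E)%E.
    rewrite /jump_density ge0_integral_levy0//.
    - apply: measurable_gauss_kernel => //; exact: measurable_funTS.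
    - by move=> w; exact: gauss_density_ge0.
  split.
  - by apply: eq_integrable i1 => // y _; rewrite jE.
  - apply: eq_integrable i2 => // w; rewrite inE => /Dgt0 w0; exact: JE.
  - under eq_integral do rewrite jE.
    rewrite i3; apply: eq_integral => w; rewrite inE => /Dgt0 w0; exact: JE.
split=> [e /mix[]//|].
have iQ := levy_integrable_poly numin Q1.
have -> : \int[nu]_(w in `[0, +oo[) Q.[expR (- (w / 2))] =
    fine (\int[nu]_(w in D) (Q.[expR (- (w / 2))])%:E)%E.
  by rewrite /Rintegral (integral_levy0 nu0 iQ).
apply/cvg_at_rightP => u [u0 ucvg].
have cvgJ : {ae nu, forall w, D w ->
    (J (u n) w)%:E @[n --> \oo] --> (Q.[expR (- (w / 2))])%:E}.
  apply: aeW => w /Dgt0 w0; apply: cvg_EFin; first exact: nearW.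
  have [_ /cvg_at_rightP] := integrable_is_integral_off0 (integrable_jump_poly P x s0 w0).
  by rewrite -QE// => h; have := h u (conj u0 ucvg).
have domJ : {ae nu, forall w n, D w -> (`|(J (u n) w)%:E| <= (C * Num.min 1 w)%:E)%E}.
  by apply: aeW => w n /Dgt0 w0; rewrite lee_fin; exact: hC.
have iCmin : nu.-integrable D (fun w => (C * Num.min 1 w)%:E).
  exact: (integrableZl mD C imin).
have mJ n : measurable_fun D (fun w => (J (u n) w)%:E).
  by have [_ /measurable_int] := mix _ (u0 n).
have mQ : measurable_fun D (fun w => (Q.[expR (- (w / 2))])%:E).
  by apply/measurable_EFinP/measurable_funTS; exact: measurable_expRN2.
have [iQD _ dct] := @dominated_convergence _ (measurableTypeR R) R nu D mD _ _ _
  mJ mQ cvgJ iCmin domJ.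
apply: fine_cvg; rewrite fineK; last exact: integrable_fin_num.
by move: dct; apply: cvg_trans; apply: near_eq_cvg; apply: nearW => n;
  have [] := mix _ (u0 n).
Qed.

(** * The generator *)

Lemma levy_integral_poly (R : realType)
    (nu : {measure set (measurableTypeR R) -> \bar R}) (Q : {poly R}) :
  (\int[nu]_(w in `[0%R, +oo[) (Num.min 1 w)%:E < +oo)%E ->
  \int[nu]_(w in `[0, +oo[) (Q.[expR (- (w / 2))] - Q.[1]) =
  - \sum_(j < size Q) Q`_j * laplace_exponent 0 nu (j%:R / 2).
Proof.
move=> numin.
have mI : measurable (`[0%R, +oo[%classic : set (measurableTypeR R)).
  exact: measurable_itv.
have ij (j : nat) : nu.-integrable `[0%R, +oo[
    (fun w : R => (1 - expR (- (j%:R / 2 * w)))%:E).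
  have X1 : (1 - 'X^j : {poly R}).[1] = 0.
    by rewrite hornerD hornerN hornerXn hornerC expr1n subrr.
  apply: eq_integrable (levy_integrable_poly numin X1) => // w _.
  rewrite hornerD hornerN hornerXn hornerC -expRM_natl; congr (1 - expR _)%:E.
  by field.
transitivity (\int[nu]_(w in `[0, +oo[)
    (\sum_(j < size Q) - Q`_j * (1 - expR (- (j%:R / 2 * w))))).
  apply: eq_Rintegral => w _; rewrite !horner_coef -sumrB; apply: eq_bigr => j _.
  have -> : expR (- (w / 2)) ^+ j = expR (- (j%:R / 2 * w)).
    by rewrite -expRM_natl; congr expR; field.
  by rewrite expr1n; ring.
rewrite /Rintegral; under eq_integral do rewrite -sumEFin.
have ijZ (j : nat) : nu.-integrable `[0%R, +oo[
    (fun w : R => (- Q`_j * (1 - expR (- (j%:R / 2 * w))))%:E).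
  exact: (integrableZl mI (- Q`_j) (ij j)).
rewrite integral_sum//.
rewrite -sum_fine//; last by move=> j _; apply: integrable_fin_num => //; exact: ijZ.
rewrite -sumrN; apply: eq_bigr => j _.
transitivity (\int[nu]_(w in `[0, +oo[) (- Q`_j * (1 - expR (- (j%:R / 2 * w))))) => //.
rewrite RintegralZl; [|exact: mI|exact: ij].
by rewrite mulNr /laplace_exponent mul0r add0r.
Qed.

Lemma scaling_semigroup_poly (R : realType)
    (G : R -> probability (measurableTypeR R) R)
    (nu : {measure set (measurableTypeR R) -> \bar R}) (Q : {poly R}) (sigma : R) :
  log_convolution_semigroup G -> has_laplace_exponent G 0 nu -> 1 < sigma ->
  G sigma [set 1] = 0%E ->
  (\int[G sigma]_(r in `[0%R, 1%R[) (Q.[Num.sqrt r])%:E =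
   (\sum_(j < size Q) Q`_j * sigma `^ (- laplace_exponent 0 nu (j%:R / 2)))%:E)%E.
Proof.
move=> [G01 _] [_ _ _ _ lap] s1 G1; have s1' := ltW s1.
have m1 : measurable ([set 1] : set (measurableTypeR R)) by exact: measurable_set1.
have mI : measurable (`[0%R, 1%R[%classic : set (measurableTypeR R)).
  exact: measurable_itv.
have mIc : measurable (`[0%R, 1%R]%classic : set (measurableTypeR R)).
  exact: measurable_itv.
have msq (j : nat) : measurable_fun setT (fun r : R => Num.sqrt r ^+ j).
  apply: measurable_funX.
  exact: (continuous_measurable_fun (@sqrt_continuous R)).
have toI (f : R -> R) : measurable_fun setT f -> (forall r, 0 <= f r) ->
   (\int[G sigma]_(r in `[0%R, 1%R[) (f r)%:E = \int[G sigma]_(r in `[0%R, 1%R]) (f r)%:E)%E.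
  move=> mf f0; rewrite [RHS](@ge0_negligible_integral _ _ _ (G sigma) _ [set 1%R])//.
  - by rewrite setDitv1r.
  - exact/measurable_EFinP/measurable_funTS.
  - by move=> r _; rewrite lee_fin.
have mom (j : nat) : (\int[G sigma]_(r in `[0%R, 1%R[) (Num.sqrt r ^+ j)%:E =
    (sigma `^ (- laplace_exponent 0 nu (j%:R / 2)))%:E)%E.
  rewrite (toI _ (msq j)) => [|r]; last by rewrite exprn_ge0// sqrtr_ge0.
  case: j => [|j].
    rewrite mul0r /laplace_exponent mul0r add0r.
    under eq_Rintegral do rewrite mul0r oppr0 expR0 subrr.
    rewrite /Rintegral integral0 oppr0 powRr0.
    under eq_integral do rewrite expr0.
    by rewrite integral_cst// mul1e; exact: G01.
  rewrite -lap//.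
  apply: eq_integral => r; rewrite inE/= in_itv/= => /andP[r0 _].
  by rewrite -powR_mulrn ?sqrtr_ge0// -powR12_sqrt// -powRrM mulrC.
have ij (j : nat) : (G sigma).-integrable `[0%R, 1%R[ (fun r => (Num.sqrt r ^+ j)%:E).
  apply: measurable_bounded_integrable => //.
  - by apply: le_lt_trans (probability_le1 _ _) _; rewrite ?ltry.
  - exact: measurable_funTS (msq j).
  exists 1; split; first exact: num_real.
  move=> M M1 r /=; rewrite in_itv/= => /andP[r0 r1]; apply: le_trans (ltW M1).
  rewrite ger0_norm ?exprn_ge0 ?sqrtr_ge0// exprn_ile1 ?sqrtr_ge0//.
  by rewrite -sqrtr1 ler_sqrt// ltW.
have ijZ (j : nat) : (G sigma).-integrable `[0%R, 1%R[ (fun r => (Q`_j * Num.sqrt r ^+ j)%:E).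
  exact: (integrableZl mI Q`_j (ij j)).
under eq_integral do rewrite horner_coef -sumEFin.
rewrite integral_sum; [|exact: mI|exact: ijZ]; rewrite -sumEFin; apply: eq_bigr => j _.
under eq_integral do rewrite EFinM.
by rewrite integralZl ?mom//; exact: ij.
Qed.

Definition gauss_moment_poly (R : realType) (x s : R) (n : nat) : {poly R} :=
  gauss_moment (x%:P * 'X) (s%:P * (1 - 'X^2)) n.

Lemma horner_gauss_moment_poly (R : realType) (x s t : R) (n : nat) :
  (gauss_moment_poly x s n).[t] = gauss_moment (x * t) (s * (1 - t ^+ 2)) n.
Proof.
rewrite /gauss_moment_poly horner_gauss_moment !hornerM !hornerC hornerX.
by rewrite hornerD hornerN hornerXn hornerC.
Qed.

Lemma gauss_moment_poly1 (R : realType) (x s : R) (n : nat) :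
  (gauss_moment_poly x s n).[1] = x ^+ n.
Proof.
by rewrite horner_gauss_moment_poly expr1n subrr mulr0 mulr1 gauss_moment0.
Qed.

Lemma transition_integral_monomial (R : realType)
    (G : R -> probability (measurableTypeR R) R)
    (nu : {measure set (measurableTypeR R) -> \bar R}) (c s t x : R) (n : nat) :
  log_convolution_semigroup G -> has_laplace_exponent G 0 nu ->
  (forall sigma : R, 1 < sigma -> G sigma [set 1] = 0%E) ->
  0 < s -> s < t ->
  let Q := gauss_moment_poly x s n in
  let sigma := Num.sqrt (t / s) in
  mu.-integrable setT (fun y => (c * y ^+ n)%:E * transition_density G s t x y)%E /\
  (\int[mu]_y ((c * y ^+ n)%:E * transition_density G s t x y) =
   (c * \sum_(j < size Q) Q`_j *
      (sigma ^+ n * sigma `^ (- laplace_exponent 0 nu (j%:R / 2))))%:E)%E.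
Proof.
move=> hG hpsi hG1 s0 st Q sigma.
have t0 : 0 < t by exact: lt_trans st.
have ts : 1 < t / s by rewrite ltr_pdivlMr// mul1r.
have s1 : 1 < sigma by rewrite -sqrtr1 ltr_sqrt// (lt_trans _ ts).
have sg0 : 0 < sigma by exact: lt_trans s1.
have tE : t = sigma ^+ 2 * s.
  by rewrite sqr_sqrtr ?divfK ?gt_eqF// ltW// (lt_trans _ ts).
pose D : set (measurableTypeR R) := `[0, 1[%classic.
have mD : measurable D by exact: measurable_itv.
have D01 r : D r -> 0 <= r /\ r < 1 by rewrite /D/= in_itv/= => /andP.
have sq01 r : D r -> 0 <= Num.sqrt r <= 1.
  by move=> /D01[r0 r1]; rewrite sqrtr_ge0 -sqrtr1 ler_sqrt// ltW.
have msq : measurable_fun setT (fun r : R => Num.sqrt r).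
  exact: (continuous_measurable_fun (@sqrt_continuous R)).
have mb : measurable_fun D (fun r => sigma * Num.sqrt r * x).
  by apply: measurable_funTS; apply: measurable_funM => //; exact: measurable_funM.
have mv : measurable_fun D (fun r => t * (1 - r)).
  by apply: measurable_funTS; apply: measurable_funM => //; exact: measurable_funB.
have v0 r : D r -> 0 < t * (1 - r).
  by move=> /D01[_ r1]; rewrite mulr_gt0// subr_gt0.
have momE k r : D r ->
    \int[mu]_y (y ^+ k * gauss_density (sigma * Num.sqrt r * x) (t * (1 - r)) y) =
    sigma ^+ k * (gauss_moment_poly x s k).[Num.sqrt r].
  move=> Dr; have [r0 r1] := D01 _ Dr.
  rewrite horner_gauss_moment_poly -gauss_moment_scale (sqr_sqrtr r0).
  have -> : sigma * (x * Num.sqrt r) = 0 + sigma * Num.sqrt r * x by ring.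
  have -> : sigma ^+ 2 * (s * (1 - r)) = t * (1 - r) by rewrite tE; ring.
  rewrite -integral_gauss_moment; last exact: v0.
  by under [RHS]eq_Rintegral do rewrite add0r.
have imom (p : {poly R}) r : D r -> mu.-integrable setT
    (fun y => (p.[y] * gauss_density (sigma * Num.sqrt r * x) (t * (1 - r)) y)%:E).
  by move=> Dr; apply: integrable_poly_gauss; exact: v0.
have imomX (k : nat) r : D r -> mu.-integrable setT
    (fun y => (y ^+ k * gauss_density (sigma * Num.sqrt r * x) (t * (1 - r)) y)%:E).
  by move=> Dr; have := imom ('X^k) r Dr; under eq_fun do rewrite hornerXn.
pose B := gauss_moment_poly x s (n + n).
pose K := `|c| * (1 + sigma ^+ (n + n) * \sum_(j < size B) `|B`_j|).
have iK : (G sigma).-integrable D (fun=> K%:E).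
  exact: finite_measure_integrable_cst.
have hK r : D r -> (\int[mu]_(y in setT) (`|c * y ^+ n| *
    gauss_density (sigma * Num.sqrt r * x) (t * (1 - r)) y)%:E <= K%:E)%E.
  move=> Dr; have [r0 r1] := D01 _ Dr.
  set g := gauss_density _ _.
  have g0 y : 0 <= g y by exact: gauss_density_ge0.
  have ig : mu.-integrable setT (fun y => (g y + y ^+ (n + n) * g y)%:E).
    apply: eq_integrable (integrableD measurableT (imomX 0%N r Dr) (imomX (n + n)%N r Dr)) => // y _.
    by rewrite expr0 mul1r.
  have ic : mu.-integrable setT (fun y => (`|c * y ^+ n| * g y)%:E).
    apply: eq_integrable (integrable_abse (imom (c *: 'X^n) r Dr)) => // y _.
    by rewrite /= normrM (ger0_norm (g0 y)) hornerZ hornerXn.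
  rewrite -[leLHS]fineK ?lee_fin; last exact: integrable_fin_num ic.
  apply: (@le_trans _ _ (\int[mu]_y (`|c| * (g y + y ^+ (n + n) * g y)))).
    apply: le_Rintegral => //.
      exact: (integrableZl measurableT `|c| ig).
    move=> y _; rewrite normrM -mulrA ler_wpM2l// -{2}(mul1r (g y)) -mulrDl.
    rewrite ler_wpM2r// exprD -expr2 -(real_normK (num_real (y ^+ n))).
    set a := `|y ^+ n|; have : 0 <= (a - 1 / 2) ^+ 2 by exact: sqr_ge0.
    nra.
  rewrite RintegralZl// ler_wpM2l// RintegralD//; last 2 first.
    by apply: eq_integrable (imomX 0%N r Dr) => // y _; rewrite expr0 mul1r.
    exact: imomX.
  rewrite integral_gauss_density momE// lerD2l ler_wpM2l ?exprn_ge0 ?(ltW sg0)//.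
  by apply: (le_trans (ler_norm _)); apply: horner_le_sum; exact: sq01.
have mh : measurable_fun setT (fun y : R => c * y ^+ n).
  by apply: measurable_funM => //; exact: measurable_funX.
have tdE y : transition_density G s t x y =
    (\int[G sigma]_(r in D) (gauss_density (sigma * Num.sqrt r * x) (t * (1 - r)) y)%:E)%E.
  by rewrite /transition_density gt_eqF.
have [i1 _ i3] := @gauss_mixture_fubini R (G sigma) D setT _ _ (fun y => c * y ^+ n) _
  mD measurableT mb mv v0 mh iK hK.
split.
  by apply: eq_integrable i1 => // y _; rewrite tdE.
under eq_integral do rewrite tdE.
rewrite i3.
have -> : c * \sum_(j < size Q) Q`_j *
      (sigma ^+ n * sigma `^ (- laplace_exponent 0 nu (j%:R / 2))) =
   c * sigma ^+ n * \sum_(j < size Q) Q`_j * sigma `^ (- laplace_exponent 0 nu (j%:R / 2)).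
  by rewrite -mulrA; congr (_ * _); rewrite mulr_sumr; apply: eq_bigr => j _; rewrite mulrCA.
rewrite EFinM -(scaling_semigroup_poly Q hG hpsi s1 (hG1 _ s1)).
have mQ : measurable_fun D (fun r => (Q.[Num.sqrt r])%:E).
  apply/measurable_EFinP/measurable_funTS.
  exact: (measurableT_comp (measurable_horner Q)).
have iQ : (G sigma).-integrable D (fun r => (Q.[Num.sqrt r])%:E).
  apply: measurable_bounded_integrable => //.
  - by apply: le_lt_trans (probability_le1 _ _) _; rewrite ?ltry.
  - exact/measurable_EFinP.
  exists (\sum_(j < size Q) `|Q`_j|); split; first exact: num_real.
  move=> M M1 r Dr; apply: le_trans (ltW M1).
  by apply: horner_le_sum; exact: sq01.
rewrite -integralZl//; apply: eq_integral => r; rewrite inE => Dr.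
transitivity (\int[mu]_y (c * (y ^+ n *
    gauss_density (sigma * Num.sqrt r * x) (t * (1 - r)) y)))%:E.
  rewrite /Rintegral fineK.
    by apply: eq_integral => y _; rewrite mulrA.
  apply: integrable_fin_num => //; exact: (integrableZl measurableT c (imomX n r Dr)).
by rewrite RintegralZl ?imomX// momE// -EFinM mulrA.
Qed.

Lemma powR_right_derivative (R : realType) (a s : R) : 0 < s ->
  ((t / s) `^ a - 1) / (t - s) @[t --> s^'+] --> a / s.
Proof.
move=> s0; pose E (t : R) := expR (a * (ln t - ln s)).
have Es : E s = 1 by rewrite /E subrr mulr0 expR0.
have dl : is_derive s 1 (fun t : R => a * (ln t - ln s)) (a / s).
  have d0 := is_deriveB (is_derive1_ln s0) (is_derive_cst (ln s) s 1).
  have := is_deriveZ a d0; rewrite subr0 => d1.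
  exact: d1.
have dE : is_derive s 1 E (a / s).
  have de : is_derive (a * (ln s - ln s)) 1 expR (expR (a * (ln s - ln s))).
    exact: is_derive_expR.
  have := @is_derive1_comp _ expR (fun t : R => a * (ln t - ln s)) s _ _ de dl.
  by rewrite subrr mulr0 expR0 mul1r.
have cE := is_derive_quotient dE.
have ct : t - s @[t --> s^'+] --> (0 : R)^'.
  move=> P hP.
  have c0 : t - s @[t --> s^'+] --> (0 : R).
    rewrite -(subrr s); apply: cvgB; last exact: cvg_cst.
    by apply: cvg_within_filter; exact: cvg_id.
  have h : \forall t \near s^'+, t - s != 0 -> P (t - s) := c0 _ hP.
  change (\forall t \near s^'+, P (t - s)).
  near=> t; have : t - s != 0 -> P (t - s) by near: t.
  by apply; rewrite subr_eq0 gt_eqF//; near: t; exact: nbhs_right_gt.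
have := cvg_comp _ _ ct cE; apply: cvg_trans; apply: near_eq_cvg; near=> t.
have st : s < t by near: t; exact: nbhs_right_gt.
have t0 : 0 < t by exact: lt_trans st.
rewrite /= subrK Es /E /powR gt_eqF ?divr_gt0//.
by rewrite lnM ?posrE ?invr_gt0// lnV.
Unshelve. all: by end_near. Qed.

Lemma sqrt_powR_mul (R : realType) (n : nat) (a r : R) : 0 < r ->
  Num.sqrt r ^+ n * Num.sqrt r `^ (- a) = r `^ ((n%:R - a) / 2).
Proof.
move=> r0; rewrite -powR_mulrn ?sqrtr_ge0//.
have sn0 : Num.sqrt r != 0 by rewrite gt_eqF// sqrtr_gt0.
rewrite -powRD ?sn0 ?implybT//.
by rewrite -powR12_sqrt ?ltW// -powRrM mulrC.
Qed.

Lemma generator_limit (R : realType) (c s : R) (N : nat) (q a : nat -> R) :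
  0 < s ->
  (t - s)^-1 * (c * (\sum_(j < N) q j * (t / s) `^ a j) - c * \sum_(j < N) q j)
    @[t --> s^'+] --> c / s * \sum_(j < N) q j * a j.
Proof.
move=> s0.
have S : \sum_(j < N) q j * (((t / s) `^ a j - 1) / (t - s)) @[t --> s^'+] -->
    \sum_(j < N) q j * (a j / s).
  elim: N => [|N IH].
    by rewrite big_ord0; under eq_fun do rewrite big_ord0; exact: cvg_cst.
  rewrite big_ord_recr /=; under eq_fun do rewrite big_ord_recr /=.
  apply: cvgD; first exact: IH.
  by apply: cvgMr; exact: powR_right_derivative.
have cS : c * \sum_(j < N) q j * (((t / s) `^ a j - 1) / (t - s)) @[t --> s^'+] -->
    c * \sum_(j < N) q j * (a j / s) by exact: cvgMr.
rewrite [X in _ --> X](_ : _ = c * \sum_(j < N) q j * (a j / s)); last first.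
  rewrite -mulrA; congr (c * _); rewrite mulr_sumr; apply: eq_bigr => j _.
  by rewrite mulrCA (mulrC s^-1).
apply: cvg_trans cS; apply: near_eq_cvg; apply: nearW => t /=.
rewrite -mulrBr -sumrB mulrCA; congr (c * _); rewrite mulr_sumr.
by apply: eq_bigr => j _; rewrite mulrA mulrBr mulr1 mulrC.
Qed.

Theorem proposition10 (R : realType)
    (G : R -> probability (measurableTypeR R) R)
    (beta : R) (nu : {measure set (measurableTypeR R) -> \bar R})
    (d : measure_display) (Omega : measurableType d) (Pr : probability Omega R)
    (X : R -> {RV Pr >-> R})
    (hG : log_convolution_semigroup G)
    (hpsi : has_laplace_exponent G beta nu)
    (hpsi_half : laplace_exponent beta nu (1 / 2) = 1)
    (hX : markov_martingale G X)
    (hG1 : forall sigma : R, 1 < sigma -> G sigma [set 1] = 0%E)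
    (hbeta : beta = 0)
    (f : R -> R) (hf : C1 f) (hfLaplace : laplace_scaling_property f)
    (s : R) (hs : 0 < s) (x : R) :
  exists I : R,
    is_integral_off0
      (fun y => (f (x + y) - f x)%:E * jump_density nu s x y)%E I /\
    is_generator G s f x
      (x / (2 * s) * f^`()%classic x + 1 / (2 * s) * I).
Proof.
have cf : continuous f.
  by move=> y; apply: differentiable_continuous; apply/derivable1_diffP; case: hf.
have [c [n fE]] := laplace_scaling_monomial cf hfLaplace.
have {}fE : f = fun w => c * w ^+ n by apply/funext.
rewrite {}hbeta in hpsi; have [_ nuC nu0 numin _] := hpsi.
rewrite fE; pose Q := gauss_moment_poly x s n.
pose psi (j : nat) := laplace_exponent 0 nu (j%:R / 2).
have Q1 : Q.[1] = x ^+ n by exact: gauss_moment_poly1.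
have sumQ : \sum_(j < size Q) Q`_j = x ^+ n.
  by rewrite -Q1 horner_coef; apply: eq_bigr => j _; rewrite expr1n mulr1.
pose S := \sum_(j < size Q) Q`_j * psi j.
exists (- (c * S)); split.
  pose P := c *: ('X + x%:P) ^+ n - (c * x ^+ n)%:P.
  have PE y : P.[y] = c * (x + y) ^+ n - c * x ^+ n.
    by rewrite /P hornerD hornerN hornerZ horner_exp hornerD hornerX !hornerC (addrC y).
  have P0 : P.[0] = 0 by rewrite PE addr0 subrr.
  pose J := c *: Q - (c * x ^+ n)%:P.
  have JE t : J.[t] = c * (Q.[t] - Q.[1]).
    by rewrite /J hornerD hornerN hornerZ hornerC Q1 mulrBr.
  have J1 : J.[1] = 0 by rewrite JE subrr mulr0.
  have QE (w : R) : 0 < w ->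
      \int[mu]_y (P.[y] * jump_gauss x s w y) = J.[expR (- (w / 2))].
    move=> w0; rewrite JE Q1 horner_gauss_moment_poly.
    have -> : expR (- (w / 2)) ^+ 2 = expR (- w).
      by rewrite expr2 -expRD; congr expR; field.
    have -> : x * expR (- (w / 2)) = x + (expR (- (w / 2)) - 1) * x by ring.
    rewrite -integral_gauss_moment; last exact: jump_var_gt0.
    have i1 := integrable_jump_poly (('X + x%:P) ^+ n) x hs w0.
    have i0 := integrable_jump_poly 1 x hs w0.
    transitivity (\int[mu]_y (c * ((('X + x%:P) ^+ n).[y] * jump_gauss x s w y) -
        c * x ^+ n * ((1 : {poly R}).[y] * jump_gauss x s w y))).
      apply: eq_Rintegral => y _.
      by rewrite PE horner_exp hornerD hornerX !hornerC (addrC y); ring.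
    rewrite RintegralB//; last 2 first.
    - exact: (integrableZl measurableT c i1).
    - exact: (integrableZl measurableT (c * x ^+ n) i0).
    rewrite !RintegralZl// mulrBr; congr (c * _ - _).
      by apply: eq_Rintegral => y _; rewrite horner_exp hornerD hornerX hornerC (addrC y).
    rewrite -[RHS]mulr1; congr (_ * _).
    by under eq_Rintegral do rewrite hornerC mul1r; exact: integral_gauss_density.
  have := jump_integral hs nuC nu0 numin P0 J1 QE.
  have -> : \int[nu]_(w in `[0, +oo[) J.[expR (- (w / 2))] = - (c * S).
    rewrite -mulrN -(levy_integral_poly Q numin) -RintegralZl.
    - by apply: eq_Rintegral => w _; rewrite JE.
    - exact: measurable_itv.
    - have Q0 : (Q - Q.[1]%:P).[1] = 0 by rewrite hornerD hornerN hornerC subrr.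
      apply: eq_integrable (levy_integrable_poly numin Q0); first exact: measurable_itv.
      by move=> w _ /=; rewrite hornerD hornerN hornerC.
  by under eq_fun do rewrite PE.
have tr t := transition_integral_monomial c x n hG hpsi hG1 hs (t := t).
split.
  near=> t; have st : s < t by near: t; exact: nbhs_right_gt.
  by have [] := tr t st.
pose a (j : nat) := (n%:R - psi j) / 2.
have dfE : x * (fun w : R => c * w ^+ n)^`()%classic x = c * (n%:R * x ^+ n).
  have -> : (fun w : R => c * w ^+ n) = horner (c *: 'X^n).
    by apply/funext => w; rewrite hornerZ hornerXn.
  rewrite -derivE derivZ derivXn hornerZ hornerMn hornerXn.
  case: (n) => [|m]; first by rewrite mulr0n !mul0r !mulr0.
  by rewrite exprS -mulr_natl; ring.
have -> : x / (2 * s) * (fun w : R => c * w ^+ n)^`()%classic x +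
    1 / (2 * s) * - (c * S) = c / s * \sum_(j < size Q) Q`_j * a j.
  have -> : \sum_(j < size Q) Q`_j * a j = (n%:R * x ^+ n - S) / 2.
    rewrite -sumQ mulr_sumr /S -sumrB mulr_suml; apply: eq_bigr => j _.
    by rewrite /a; ring.
  have s0 : s != 0 by rewrite gt_eqF.
  rewrite mulrAC dfE; field.
  by rewrite s0.
have := @generator_limit R c s (size Q) (fun j : nat => Q`_j) a hs.
apply: cvg_trans; apply: near_eq_cvg; near=> t; have st : s < t by near: t; exact: nbhs_right_gt.
have [_ ->] := tr t st; rewrite sumQ; congr (_ * (c * _ - _)).
apply: eq_bigr => j _; rewrite sqrt_powR_mul// divr_gt0//; exact: lt_trans st.
Unshelve. all: by end_near. Qed.
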